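(* Let $r=r(n)$, $s=s(n)$ satisfy $n\gg r(n)\gg s(n)$. Denote $G_n=G(n,r,s)$, $d_n=d(G(n,r,s))$, $N_n=\binom{n}{r}$, and let $G_n(p)$ denote the random subgraph of $G_n$ with edge retention probability $p$. Then: 1. For any fixed $0<\alpha<1$, w.h.p. all components of $G_n(\frac{\alpha}{d_n})$ have size $O(\log(N_n))$. 2. For any fixed $\alpha>1$, w.h.p. there exists a component of size $(1+o(1))(1-\frac{\overline{\alpha}}{\alpha})N_n$ in $G_n(\frac{\alpha}{d_n})$, where $\overline{\alpha}$ is the solution of $xe^{-x}=\alpha e^{-\alpha}$ different from $\alpha$. At the same time, all other components of $G_n(\frac{\alpha}{d_n})$ have size $O(\log(N_n))$.
   Context: For integers $n,r,s$, the Johnson graph $G(n,r,s)$ has as vertices all vectors $v\in\{0,1\}^n$ with exactly $r$ ones; two vertices are joined by an edge if and only if their inner product equals $s$. It is regular; $d(G)$ denotes the vertex degree of a regular graph $G$, so $d(G(n,r,s))=\binom{r}{s}\binom{n-r}{r-s}$. For a graph $G$ and $p\in[0,1]$, $G(p)$ is the random graph obtained from $G$ by removing every edge with probability $1-p$ independently of all other edges. ''W.h.p.'' means with probability tending to $1$ as $n\to\infty$. The size of a component is its number of vertices. $f(n)\gg g(n)$ means $f(n)/g(n)\to\infty$ as $n\to\infty$. *)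

(* Defs.v *)
From HB Require Import structures.
From mathcomp Require Import all_boot all_order all_algebra.
From mathcomp Require Import all_classical all_reals all_analysis.
Set Implicit Arguments.
Unset Strict Implicit.
Unset Printing Implicit Defensive.
Import Order.TTheory GRing.Theory Num.Theory.
Import numFieldNormedType.Exports.
Local Open Scope ring_scope.

(* The quotient is taken in the extended reals, where a / 0 = +oo for a > 0
   and 0 / 0 = 0. *)
Definition much_larger (R : realType) (f g : nat -> nat) : Prop :=
  (((f n)%:R%:E / (g n)%:R%:E)%E @[n --> \oo] --> (+oo : \bar R)%E)%classic.

Section Graphs.
Variables (T : finType) (adj : rel T).

Definition neighbors (v : T) : {set T} := [set u | adj v u].

(* Maximum degree; on a regular graph it is the common vertex degree
   (see johnson_degreeE for Johnson graphs). *)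
Definition degree : nat := (\max_v #|neighbors v|)%N.

Definition edges : {set {set T}} :=
  [set [set x.1; x.2] | x in [set x : T * T | adj x.1 x.2]].

End Graphs.

(* Vertex sets of the connected components of the graph on T with edge set F. *)
Definition components (T : finType) (F : {set {set T}}) : {set {set T}} :=
  [set [set v | connect (fun x y => [set x; y] \in F) u v] | u : T].

(* Probability, for p in [0, 1], that the edge set of the random subgraph G(p)
   satisfies A, where G is the graph with adjacency relation adj. *)
Definition subgraph_prob (R : realType) (T : finType) (adj : rel T) (p : R)
    (A : pred {set {set T}}) : R :=
  \sum_(F in powerset (edges adj) | A F)
    p ^+ #|F| * (1 - p) ^+ #|edges adj :\: F|.

Definition johnson_vertex (n r : nat) : finType :=
  {v : {ffun 'I_n -> bool} | (\sum_i v i)%N == r}.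

Definition inner_product (n : nat) (u v : {ffun 'I_n -> bool}) : nat :=
  (\sum_i u i * v i)%N.

(* The condition u != v rules out loops, which only matters when s = r. *)
Definition johnson_adj (n r s : nat) : rel (johnson_vertex n r) :=
  fun u v => (u != v) && (inner_product (val u) (val v) == s).

Lemma johnson_adj_sym n r s : symmetric (@johnson_adj n r s).
Proof.
move=> u v; rewrite /johnson_adj eq_sym /inner_product; congr (_ && (_ == _)).
by apply: eq_bigr => i _; rewrite mulnC.
Qed.

Lemma johnson_adj_irr n r s : irreflexive (@johnson_adj n r s).
Proof. by move=> u; rewrite /johnson_adj eqxx. Qed.

Lemma sum_indicator (n : nat) (P : pred 'I_n) :
  (\sum_i P i)%N = #|[set i | P i]|.
Proof.
rewrite -sum1_card [RHS]big_mkcond /=; apply: eq_bigr => i _.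
by rewrite inE; case: (P i).
Qed.

Lemma johnson_card n r : #|johnson_vertex n r| = 'C(n, r).
Proof.
rewrite -[n in 'C(n, _)]card_ord -card_draws card_sig.
pose f (v : {ffun 'I_n -> bool}) : {set 'I_n} := [set i | v i].
have f_inj : injective f.
  move=> u v /setP e; apply/ffunP => i; have := e i.
  by rewrite !inE.
rewrite -(card_imset _ f_inj); apply: eq_card => A; rewrite inE.
apply/imsetP/idP => [[v + ->]|/eqP cA].
  by rewrite inE /= sum_indicator.
exists [ffun i => i \in A].
  rewrite inE /= sum_indicator -cA; apply/eqP/eq_card => i.
  by rewrite inE ffunE.
by apply/setP => i; rewrite inE ffunE.
Qed.

Lemma johnson_neighbors n r s (v : johnson_vertex n r) : (s < r)%N ->
  #|neighbors (@johnson_adj n r s) v| = ('C(r, s) * 'C(n - r, r - s))%N.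
Proof.
move=> sr; pose A : {set 'I_n} := [set i | val v i].
have cA : #|A| = r by rewrite -sum_indicator; exact/eqP/(valP v).
have cAC : #|~: A| = (n - r)%N by rewrite cardsCs finset.setCK cA card_ord.
pose f (u : johnson_vertex n r) :=
  (A :&: [set i | val u i], [set i | val u i] :\: A).
have f_inj : injective f.
  move=> u w [/setP e1 /setP e2]; apply/val_inj/ffunP => i.
  by have := e1 i; have := e2 i; rewrite !inE; case: (val v i).
rewrite -cAC -[X in 'C(X, s)]cA -!cards_draws -cardsX -(card_imset _ f_inj).
apply: eq_card => -[C D]; rewrite !inE /=.
have ipE (u : johnson_vertex n r) :
    inner_product (val v) (val u) = #|A :&: [set i | val u i]|.
  rewrite /inner_product -[RHS](eq_card (A := [set i | val v i && val u i])).
    rewrite -(sum_indicator (fun i => val v i && val u i)).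
    by apply: eq_bigr => i _; rewrite mulnb.
  by move=> i; rewrite !inE.
apply/imsetP/idP => [[u + [-> ->]]|].
  rewrite inE /johnson_adj ipE => /andP[_ /eqP cI].
  rewrite finset.subsetIl cI eqxx /= finset.setDE finset.subsetIr /=.
  have := cardsID A [set i | val u i]; rewrite finset.setIC cI.
  rewrite -(sum_indicator (val u)) (eqP (valP u)).
  by rewrite -finset.setDE => e; rewrite -[X in (X - s)%N]e addKn eqxx.
move=> /andP[/andP[CA /eqP cC] /andP[DA /eqP cD]].
have dCD : C :&: D = finset.set0.
  apply/setP => i; rewrite !inE; apply/negbTE/negP => /andP[iC iD].
  by have := fintype.subsetP DA _ iD; rewrite inE (fintype.subsetP CA _ iC).
have ufP : (\sum_i [ffun i => i \in C :|: D] i)%N == r.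
  rewrite sum_indicator (eq_card (B := C :|: D)); last first.
    by move=> i; rewrite inE ffunE.
  by rewrite cardsU dCD cards0 subn0 cC cD subnKC // ltnW.
pose u : johnson_vertex n r :=
  exist (fun v : {ffun 'I_n -> bool} => (\sum_i v i)%N == r) _ ufP.
have uE : [set i | val u i] = C :|: D.
  by apply/setP => i; rewrite inE /= ffunE.
have AE : A :&: (C :|: D) = C.
  apply/setP => i; rewrite finset.in_setI finset.in_setU.
  case: (boolP (i \in C)) => [/(fintype.subsetP CA) -> //|_] /=.
  by apply/negP => /andP[iA /(fintype.subsetP DA)]; rewrite inE iA.
exists u; rewrite /f ?uE ?AE.
  rewrite inE /johnson_adj ipE uE AE cC eqxx andbT.
  apply: contraTneq sr => vu; rewrite -leqNgt.
  have EA : A = C :|: D by rewrite -uE -vu.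
  by rewrite -cC -AE -EA finset.setIid cA.
congr (_, _); apply/setP => i; rewrite finset.in_setD finset.in_setU.
case: (boolP (i \in A)) => [iA|iA] /=.
  by apply/negP => /(fintype.subsetP DA); rewrite inE iA.
by case: (boolP (i \in C)) => // /(fintype.subsetP CA); rewrite (negbTE iA).
Qed.

Lemma johnson_degreeE n r s : (s < r <= n)%N ->
  degree (@johnson_adj n r s) = ('C(r, s) * 'C(n - r, r - s))%N.
Proof.
move=> /andP[sr rn]; rewrite /degree.
under eq_bigr do rewrite johnson_neighbors //.
have /card_gt0P[v _] : (0 < #|johnson_vertex n r|)%N.
  by rewrite johnson_card bin_gt0.
apply/eqP; rewrite eqn_leq (leq_bigmax v) andbT.
by apply/bigmax_leqP.
Qed.

(* Main.v *)
Require Import Defs.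
From mathcomp Require Import all_boot all_order all_algebra perm reals.
From mathcomp Require Import ring lra zify.
Import Order.TTheory GRing.Theory Num.Theory.
Set Implicit Arguments.
Unset Strict Implicit.
Unset Printing Implicit Defensive.
Local Open Scope ring_scope.

(* Write P_p for the percolation measure and, for a set S of k vertices, compare
   the probabilities that S is a component at two densities q < p.  Thinning the
   inside of S from p to q preserves a spanning tree with probability at least
   (q/p)^(k-1), while the number of boundary edges of S is nearly kd; hence
   P_p(S) / P_q(S) is squeezed between (p/q)^(k-1) ((1-p)/(1-q))^(kd) and
   (p/q)^(k-1) ((1-p)/(1-q))^(boundary of S).
   - With densities alpha/d and 1/d this ratio is exponentially small in k: always
     for alpha < 1, and as long as k <= b N for alpha > 1, because the graph is
     pseudo-random.  So there are no components of intermediate size.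
   - With densities alpha/d and alpha'/d it tends to q = alpha'/alpha for fixed k.
     As alpha' < 1, almost all vertices lie in bounded components at density
     alpha'/d, so about q N vertices do so at density alpha/d; a second moment
     bound gives concentration.
   - Sprinkling a few edges on a slightly smaller density merges all components of
     linear size, which makes the giant component unique.
   Pseudo-randomness of G(n,r,s): if a transposition of coordinates maps v to v',
   it maps the neighbours of v to those of v' and fixes all but a fraction
   s/r + (r-s)/(n-r) of them.  So averaging over neighbours contracts the Lipschitz
   seminorm, and therefore also the l2 norm on functions of mean 0, by this factor. *)

(** * Product measures on finite sets *)

(** The comparison bounds are strong because they are summed against a quantity known at every
    density: components partition the vertices, so the sum over [S] of [#|S|] times the probability
    that [S] is a component equals N. Connected sets are never counted and no exploration process is
    followed. Upper bounds need only this trivial total at the other density. The lower bound on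
    small components also needs the total at the other density to sit on bounded sizes; this is
    where subcriticality of alpha' enters.

    The obstacle is that the upper comparison sees the true edge boundary of [S] instead of kd. For
    sizes up to a fixed K the defect is at most K^2, harmless as d grows; for sizes up to b N it is
    controlled by mixing. Mixing error is only ever compared with fixed positive constants, so it is
    enough that the spectral ratio tends to 0, at any rate, and a contraction estimate can replace
    the exact eigenvalues of the Johnson scheme. *)

Section ProductMeasure.
Variables (R : realFieldType) (E : finType).
Implicit Types (p : E -> R) (F B : {set E}) (f g : {set E} -> R)
  (A : pred {set E}).

Definition bern (x : R) (b : bool) : R := if b then x else 1 - x.

Definition wt p F : R := \prod_e bern (p e) (e \in F).

Definition expect p f : R := \sum_F wt p F * f F.

Definition prob p A : R := expect p (fun F => (A F)%:R).

Definition is_prob p := forall e, 0 <= p e <= 1.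

Definition combine (op : E -> bool -> bool -> bool) F1 F2 : {set E} :=
  [set e | op e (e \in F1) (e \in F2)].

Lemma bern_ge0 x b : 0 <= x <= 1 -> 0 <= bern x b.
Proof. by case: b => /andP[x0 x1] //=; rewrite subr_ge0. Qed.

Lemma bern_total x : bern x true + bern x false = 1.
Proof. by rewrite /bern addrC subrK. Qed.

Lemma wt_ge0 p F : is_prob p -> 0 <= wt p F.
Proof. by move=> p01; apply: prodr_ge0 => e _; exact: bern_ge0. Qed.

Lemma sum_set_prod (h : E -> bool -> R) :
  \sum_(F : {set E}) \prod_e h e (e \in F) = \prod_e (h e true + h e false).
Proof.
rewrite bigA_distr; apply: eq_bigr => F _; apply: eq_bigr => e _.
by case: (e \in F).
Qed.

Lemma eq_expect p f g : f =1 g -> expect p f = expect p g.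
Proof. by move=> fg; apply: eq_bigr => F _; rewrite fg. Qed.

Lemma eq_prob p A A' : A =1 A' -> prob p A = prob p A'.
Proof. by move=> AA; apply: eq_expect => F; rewrite AA. Qed.

Lemma eq_expectp p q f : p =1 q -> expect p f = expect q f.
Proof.
move=> pq; apply: eq_bigr => F _; congr (_ * _).
by apply: eq_bigr => e _; rewrite pq.
Qed.

Lemma expect_prod p (h : E -> bool -> R) :
  expect p (fun F => \prod_e h e (e \in F)) =
  \prod_e (p e * h e true + (1 - p e) * h e false).
Proof.
rewrite -(sum_set_prod (fun e b => bern (p e) b * h e b)).
by apply: eq_bigr => F _; rewrite -big_split.
Qed.

Lemma expect_cst p (c : R) : expect p (fun=> c) = c.
Proof.
rewrite /expect -mulr_suml /wt (sum_set_prod (fun e b => bern (p e) b)).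
by under eq_bigr do rewrite bern_total; rewrite big1_eq mul1r.
Qed.

Lemma prob_pred0 p : prob p pred0 = 0.
Proof. by rewrite -[RHS](expect_cst p); apply: eq_expect. Qed.

Lemma expectD p f g : expect p (fun F => f F + g F) = expect p f + expect p g.
Proof. by rewrite -big_split; apply: eq_bigr => F _; rewrite /= mulrDr. Qed.

Lemma expectZ p c f : expect p (fun F => c * f F) = c * expect p f.
Proof. by rewrite mulr_sumr; apply: eq_bigr => F _; rewrite mulrCA. Qed.

Lemma expect_sum p (I : finType) (P : pred I) (f : I -> {set E} -> R) :
  expect p (fun F => \sum_(i | P i) f i F) = \sum_(i | P i) expect p (f i).
Proof.
rewrite /expect exchange_big; apply: eq_bigr => F _ /=.
by rewrite mulr_sumr.
Qed.

Lemma ler_expect p f g : is_prob p -> (forall F, f F <= g F) ->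
  expect p f <= expect p g.
Proof.
move=> p01 fg; apply: ler_sum => F _.
by rewrite ler_wpM2l ?wt_ge0.
Qed.

Lemma expect_ge0 p f : is_prob p -> (forall F, 0 <= f F) -> 0 <= expect p f.
Proof. by move=> p01 f0; apply: sumr_ge0 => F _; rewrite mulr_ge0 ?wt_ge0. Qed.

Lemma prob_ge0 p A : is_prob p -> 0 <= prob p A.
Proof. by move=> p01; apply: expect_ge0. Qed.

Lemma ler_prob p A A' : is_prob p -> (forall F, A F -> A' F) ->
  prob p A <= prob p A'.
Proof.
move=> p01 AA'; apply: ler_expect => // F.
by rewrite ler_nat; case: (A F) (AA' F) => // ->.
Qed.

Lemma prob_le1 p A : is_prob p -> prob p A <= 1.
Proof.
move=> p01; rewrite -[leRHS](expect_cst p 1); apply: ler_expect => // F.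
by case: (A F).
Qed.

Lemma probC p A : prob p (predC A) = 1 - prob p A.
Proof.
apply/eqP; rewrite -[X in _ == X - _](expect_cst p 1) eq_sym subr_eq -expectD.
by apply/eqP/eq_expect => F /=; case: (A F); rewrite ?addr0 ?add0r.
Qed.

Lemma prob_le_union p A A1 A2 : is_prob p ->
  (forall F, A F -> A1 F || A2 F) -> prob p A <= prob p A1 + prob p A2.
Proof.
move=> p01 AA; rewrite -expectD; apply: ler_expect => // F.
move: (AA F); case: (A F) => [/(_ isT)|_]; last by rewrite addr_ge0.
by case: (A1 F) => /=; case: (A2 F) => //= _; rewrite ?lerDl ?addr0 ?add0r.
Qed.

Lemma finite_markov p f A c : is_prob p -> 0 <= c -> (forall F, 0 <= f F) ->
  (forall F, A F -> c <= f F) -> c * prob p A <= expect p f.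
Proof.
move=> p01 c0 f0 Af; rewrite -expectZ; apply: ler_expect => // F.
by case: (A F) (Af F) => [/(_ isT)|_]; rewrite ?mulr1 ?mulr0.
Qed.

Lemma finite_chebyshev p f A (m c v : R) : is_prob p -> 0 < c ->
  expect p f = m -> expect p (fun F => f F ^+ 2) <= m ^+ 2 + v ->
  (forall F, A F -> c <= `|f F - m|) -> c ^+ 2 * prob p A <= v.
Proof.
move=> p01 c0 fm fv Ac.
apply: (@le_trans _ _ (expect p (fun F => (f F - m) ^+ 2))).
  apply: finite_markov => //; [exact: sqr_ge0|by move=> F; exact: sqr_ge0|].
  by move=> F /Ac cf; rewrite -(real_normK (num_real (f F - m))) lerXn2r ?nnegrE // ltW.
rewrite (@eq_expect _ _ (fun F => f F ^+ 2 + ((- (m *+ 2)) * f F + m ^+ 2))).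
  by rewrite !expectD expectZ fm expect_cst; move: fv; rewrite !mulr2n; nra.
by move=> F; rewrite mulr2n; ring.
Qed.

(* Instances: intersection (thinning), union (sprinkling), and gluing a set
   along B with one along the complement of B (independence). *)
Lemma expect_combine p1 p2 p (op : E -> bool -> bool -> bool) f :
  (forall e, \sum_b1 \sum_b2
     bern (p1 e) b1 * bern (p2 e) b2 * (op e b1 b2)%:R = p e) ->
  expect p1 (fun F1 => expect p2 (fun F2 => f (combine op F1 F2))) =
  expect p f.
Proof.
move=> opE.
(* [opE] only gives the probability of [true]; that of [false] is its complement. *)
have bE e b : \sum_b1 \sum_b2
     bern (p1 e) b1 * bern (p2 e) b2 * (op e b1 b2 == b)%:R = bern (p e) b.
  case: b => /=.
    rewrite -(opE e); apply: eq_bigr => b1 _; apply: eq_bigr => b2 _.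
    by rewrite eqb_id.
  rewrite -(opE e) !big_bool /= !eqbF_neg.
  do 4!case: (op _ _ _) => /=; rewrite /bern ?mulr1 ?mulr0; ring.
pose h F e b1 b2 :=
  bern (p1 e) b1 * bern (p2 e) b2 * (op e b1 b2 == (e \in F))%:R.
(* The push-forward is again a product measure, since [op] acts on each coordinate separately. *)
have wtE F : wt p F = \sum_F1 \sum_F2 wt p1 F1 * wt p2 F2 *
    (combine op F1 F2 == F)%:R.
  transitivity (\sum_(F1 : {set E}) \sum_(F2 : {set E})
     \prod_e h F e (e \in F1) (e \in F2)).
    under eq_bigr do rewrite (sum_set_prod (fun e b => h F e (e \in _) b)).
    rewrite (sum_set_prod (fun e b1 => h F e b1 true + h F e b1 false)).
    by apply: eq_bigr => e _; rewrite -bE /h !big_bool.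
  apply: eq_bigr => F1 _; apply: eq_bigr => F2 _; rewrite /h !big_split /=.
  congr (_ * _); case: eqP => [<-|neq].
    by rewrite big1 // => e _; rewrite inE eqxx.
  apply/eqP/prodf_eq0.
  have [e he] : exists e, op e (e \in F1) (e \in F2) != (e \in F).
    apply/existsP; rewrite -negb_forall; apply/negP => /forallP H.
    by apply: neq; apply/setP => e; rewrite inE; apply/eqP.
  by exists e => //; rewrite (negbTE he).
rewrite [RHS]/expect.
under [RHS]eq_bigr do rewrite wtE mulr_suml.
rewrite exchange_big /=; apply: eq_bigr => F1 _.
rewrite /expect mulr_sumr.
under [RHS]eq_bigr do rewrite mulr_suml.
rewrite exchange_big /=; apply: eq_bigr => F2 _.
rewrite (bigD1 (combine op F1 F2)) //= eqxx mulr1 big1 ?addr0 ?mulrA //.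
by move=> F; rewrite eq_sym => /negbTE ->; rewrite mulr0 mul0r.
Qed.

(** Measurability of [f] with respect to the coordinates in [B]. *)
Definition determined B (X : Type) (f : {set E} -> X) :=
  forall F F', F :&: B = F' :&: B -> f F = f F'.

Definition glue B := combine (fun e b1 b2 => if e \in B then b1 else b2).

Lemma glueI B F1 F2 : glue B F1 F2 :&: B = F1 :&: B.
Proof. by apply/setP => e; rewrite !inE; case: (e \in B); rewrite ?andbF. Qed.

Lemma glueIC B F1 F2 : glue B F1 F2 :&: ~: B = F2 :&: ~: B.
Proof. by apply/setP => e; rewrite !inE; case: (e \in B); rewrite ?andbF. Qed.

Lemma expect_glue B p1 p2 f :
  expect p1 (fun F1 => expect p2 (fun F2 => f (glue B F1 F2))) =
  expect (fun e => if e \in B then p1 e else p2 e) f.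
Proof.
apply: expect_combine => e; rewrite !big_bool /=.
by case: (e \in B) => /=; rewrite /bern; ring.
Qed.

Lemma expect_indep B p f g : determined B f -> determined (~: B) g ->
  expect p (fun F => f F * g F) = expect p f * expect p g.
Proof.
move=> fB gB.
rewrite (@eq_expectp p (fun e => if e \in B then p e else p e)); last first.
  by move=> e; case: ifP.
rewrite -expect_glue.
under eq_expect => F1.
  under eq_expect => F2.
    rewrite (fB _ F1); last exact: glueI.
    rewrite (gB _ F2); last exact: glueIC.
    over.
  rewrite expectZ mulrC; over.
by rewrite expectZ mulrC.
Qed.

(** Gluing resamples the coordinates outside [B], which [f] does not see, so the densities there can
    be replaced at will. *)
Lemma expect_determined B p q f : determined B f ->
  (forall e, e \in B -> p e = q e) -> expect p f = expect q f.
Proof.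
move=> fB pq; pose m e := if e \in B then p e else q e.
have -> : expect p f = expect m f.
  rewrite -(expect_glue B p q).
  under [RHS]eq_expect => F1.
    under eq_expect => F2 do rewrite (fB _ F1) ?glueI //.
    rewrite expect_cst; over.
  by [].
by apply: eq_expectp => e; rewrite /m; case: ifP => // /pq.
Qed.

Lemma prob_indep B p A A' : determined B A -> determined (~: B) A' ->
  prob p (fun F => A F && A' F) = prob p A * prob p A'.
Proof.
move=> AB A'B; rewrite -(@expect_indep B).
- by apply: eq_expect => F; rewrite -mulnb natrM.
- by move=> F F' /AB ->.
- by move=> F F' /A'B ->.
Qed.

Lemma prob_determined B p q A : determined B A ->
  (forall e, e \in B -> p e = q e) -> prob p A = prob q A.
Proof. by move=> AB; apply: expect_determined => F F' /AB ->. Qed.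

Lemma prob_disjoint p B :
  prob p (fun F => [disjoint B & F]) = \prod_(e in B) (1 - p e).
Proof.
rewrite big_mkcond /prob /=.
rewrite (@eq_expect _ _ (fun F => \prod_e (if e \in B then (e \notin F)%:R else 1))).
  rewrite (expect_prod p (fun e b => if e \in B then (~~ b)%:R else 1)).
  apply: eq_bigr => e _; case: (e \in B) => /=; first by rewrite mulr0 add0r mulr1.
  by rewrite !mulr1 addrC subrK.
move=> F; case: (boolP [disjoint B & F]) => BF.
  rewrite big1 // => e _; case: ifP => // eB.
  by rewrite (disjointFr BF eB).
apply/esym/eqP/prodf_eq0; move: BF; rewrite -setI_eq0 => /set0Pn[e].
by rewrite inE => /andP[eB eF]; exists e => //; rewrite eB eF.
Qed.

Lemma prob_subset p B :
  prob p (fun F => B \subset F) = \prod_(e in B) p e.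
Proof.
rewrite big_mkcond /prob /=.
rewrite (@eq_expect _ _ (fun F => \prod_e (if e \in B then (e \in F)%:R else 1))).
  rewrite (expect_prod p (fun e b => if e \in B then b%:R else 1)).
  apply: eq_bigr => e _; case: (e \in B) => /=; first by rewrite mulr0 addr0 mulr1.
  by rewrite !mulr1 addrC subrK.
move=> F; case: (boolP (B \subset F)) => BF.
  by rewrite big1 // => e _; case: ifP => // /(subsetP BF) ->.
apply/esym/eqP/prodf_eq0; move/subsetPn: BF => [e eB eF].
by exists e => //; rewrite eB (negbTE eF).
Qed.

Lemma expect_thin p q f :
  expect p (fun F => expect q (fun Q => f (F :&: Q))) =
  expect (fun e => p e * q e) f.
Proof.
rewrite -(@expect_combine p q (fun e => p e * q e) (fun _ => andb)); last first.
  by move=> e; rewrite !big_bool /bern /=; ring.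
by apply: eq_expect => F; apply: eq_expect => Q; congr f.
Qed.

Lemma expect_sprinkle p q f :
  expect p (fun F => expect q (fun Q => f (F :|: Q))) =
  expect (fun e => 1 - (1 - p e) * (1 - q e)) f.
Proof.
rewrite -(@expect_combine p q (fun e => 1 - (1 - p e) * (1 - q e))
  (fun _ => orb)); last first.
  by move=> e; rewrite !big_bool /bern /=; ring.
by apply: eq_expect => F; apply: eq_expect => Q; congr f.
Qed.

End ProductMeasure.

(** * Components *)

Section Components.
Variable T : finType.
Implicit Types (F : {set {set T}}) (S U : {set T}).

Definition join F : rel T := fun x y => [set x; y] \in F.

Definition cc F v : {set T} := [set w | connect (join F) v w].

Lemma join_connect_sym F : connect_sym (join F).
Proof. by apply: sym_connect_sym => x y; rewrite /join setUC. Qed.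

Lemma connect_stable F (P : {set T}) v w : v \in P ->
  (forall u x, u \in P -> [set u; x] \in F -> x \in P) ->
  connect (join F) v w -> w \in P.
Proof.
move=> vP cl /connectP[q + ->]; elim: q v vP => //= x q IH v vP /andP[vx].
by apply: IH; exact: cl vx.
Qed.

Lemma cc_components F v : cc F v \in components F.
Proof. by apply/imsetP; exists v. Qed.

Lemma in_cc F v : v \in cc F v.
Proof. by rewrite inE connect0. Qed.

Lemma component_cc F S v : S \in components F -> v \in S -> S = cc F v.
Proof.
move=> /imsetP[u _ ->]; rewrite inE => uv; apply/setP => w; rewrite !inE.
exact: (same_connect (@join_connect_sym F) uv).
Qed.

Lemma component_n0 F S : S \in components F -> exists v, v \in S.
Proof. by move=> /imsetP[u _ ->]; exists u; rewrite inE connect0. Qed.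

Lemma component_closed F S u w : S \in components F -> u \in S ->
  [set u; w] \in F -> w \in S.
Proof.
by move=> SF uS uw; rewrite (component_cc SF uS) inE connect1.
Qed.

Lemma componentI F S v : v \in S ->
  (forall u w, u \in S -> [set u; w] \in F -> w \in S) ->
  (forall w, w \in S -> connect (join F) v w) -> S \in components F.
Proof.
move=> vS cl co; suff -> : S = cc F v by exact: cc_components.
apply/setP => w; rewrite inE; apply/idP/idP; first exact: co.
exact: connect_stable.
Qed.

Lemma components_disjoint F S S' : S \in components F -> S' \in components F ->
  S != S' -> [disjoint S & S'].
Proof.
move=> SF S'F; apply: contraNT; rewrite -setI_eq0 => /set0Pn[v].
rewrite inE => /andP[vS vS'].
by rewrite (component_cc SF vS) (component_cc S'F vS').
Qed.

Lemma components_partition F : partition (components F) [set: T].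
Proof.
apply/and3P; split.
- rewrite eqEsubset subsetT /=; apply/subsetP => v _.
  by apply/bigcupP; exists (cc F v); rewrite ?cc_components ?in_cc.
- apply/trivIsetP => S S'; exact: components_disjoint.
- by apply/negP => /component_n0[v]; rewrite inE.
Qed.

(** Taken among all vertex sets, so that independence statements do not refer to the graph. *)
Definition touching S : {set {set T}} := [set e : {set T} | ~~ [disjoint e & S]].

Lemma touching2 S u w : ([set u; w] \in touching S) = (u \in S) || (w \in S).
Proof.
rewrite inE -setI_eq0; apply/set0Pn/orP => [[x]|[uS|wS]].
- by rewrite !inE => /andP[/orP[]/eqP-> ->]; [left|right].
- by exists u; rewrite !inE eqxx.
- by exists w; rewrite !inE eqxx orbT.
Qed.

(** A walk inside a component uses only edges with an endpoint in it, and on these [F] and [F']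
    agree. *)
Lemma component_local F F' S : S \in components F ->
  (forall u w, u \in S -> ([set u; w] \in F) = ([set u; w] \in F')) ->
  S \in components F'.
Proof.
move=> SF FE; have [v vS] := component_n0 SF.
apply: (componentI vS) => [u w uS|w wS].
  by rewrite -FE //; exact: component_closed.
suff : w \in S :&: cc F' v by rewrite !inE => /andP[].
have := wS; rewrite [in X in X -> _](component_cc SF vS) inE.
apply: connect_stable; first by rewrite !inE vS connect0.
move=> u x; rewrite !inE => /andP[uS vu] ux.
rewrite (component_closed SF uS ux) (connect_trans vu) //.
by rewrite connect1 // /join -FE.
Qed.

Lemma component_determined S :
  determined (touching S) (fun F => S \in components F).
Proof.
move=> F F' FF'.
have FE u w : u \in S -> ([set u; w] \in F) = ([set u; w] \in F').
  move=> uS; have := congr1 (fun A : {set {set T}} => [set u; w] \in A) FF'.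
  by rewrite !(in_setI, touching2) uS /= !andbT.
by apply/idP/idP => /component_local; apply => u w /FE.
Qed.

(** The tree grows from one vertex by adding edges of [F] that leave the current vertex set.
    Acyclicity is not recorded: thinning needs the number of edges and the fact that keeping them,
    with no edge leaving [S], keeps the component. *)
Lemma spanning_tree F S : S \in components F ->
  exists2 B : {set {set T}},
    [/\ B \subset F, #|B|.+1 = #|S| & forall e, e \in B -> e \subset S] &
    forall F', B \subset F' ->
      (forall u w, u \in S -> [set u; w] \in F' -> w \in S) ->
      S \in components F'.
Proof.
move=> SF; have [v vS] := component_n0 SF.
have grow j : (j < #|S|)%N -> exists (U : {set T}) (B : {set {set T}}),
    [/\ [/\ v \in U, U \subset S & #|U| = j.+1],
        [/\ B \subset F, #|B| = j & forall e, e \in B -> e \subset U] &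
        forall w, w \in U -> connect (join B) v w].
  elim: j => [|j IH] jS.
    exists [set v], set0; split.
    - by rewrite set11 sub1set cards1.
    - by rewrite sub0set cards0; split=> // e; rewrite inE.
    - by move=> w; rewrite inE => /eqP ->; rewrite connect0.
  have [U [B [[vU US cU] [BF cB BU] co]]] := IH (ltnW jS).
  have [u [w [uU wU uw]]] : exists u w, [/\ u \in U, w \notin U & [set u; w] \in F].
    have [[u w]|none] := pickP [pred x : T * T |
        [&& x.1 \in U, x.2 \notin U & [set x.1; x.2] \in F]].
      by move=> /and3P[/= uU wU uw]; exists u, w.
    (* If no edge of [F] leaves [U], the whole component lies in [U], which is too small. *)
    suff SU : S \subset U by move: jS; rewrite -cU ltnNge subset_leq_card.
    apply/subsetP => w; rewrite [in X in X -> _](component_cc SF vS) inE.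
    apply: connect_stable => // u x uU ux; apply/negPn/negP => xU.
    by have := none (u, x); rewrite /= uU xU ux.
  have wS : w \in S by apply: component_closed uw => //; exact: (subsetP US).
  exists (w |: U), ([set u; w] |: B); split.
  - split; first by rewrite inE vU orbT.
      by rewrite subUset sub1set wS.
    by rewrite cardsU1 wU cU.
  - split; first by rewrite subUset sub1set uw.
      rewrite cardsU1 cB; case: (boolP (_ \in B)) => // /BU /subsetP/(_ w).
      by rewrite !inE eqxx orbT (negbTE wU) => /(_ isT).
    move=> e; rewrite in_setU1 => /orP[/eqP ->|/BU eU].
      by rewrite subUset !sub1set !inE eqxx uU orbT.
    exact: subset_trans eU (subsetUr _ _).
  - have BB : subrel (connect (join B)) (connect (join ([set u; w] |: B))).
      by apply: connect_sub => x y xy; rewrite connect1 // /join in_setU1 [_ \in B]xy orbT.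
    move=> x; rewrite in_setU1 => /orP[/eqP ->|/co /BB //].
    apply: connect_trans (BB _ _ (co _ uU)) _.
    by rewrite connect1 // /join setU11.
have Sgt0 : (0 < #|S|)%N by apply/card_gt0P; exists v.
have [|U [B [[vU US cU] [BF cB BU] co]]] := grow #|S|.-1; first by rewrite prednK.
have eUS : U = S by apply/eqP; rewrite eqEcard US cU prednK //=.
rewrite eUS in BU co.
exists B => [|F' BF' cl]; first by split; rewrite ?cB ?prednK.
apply: (componentI vS) => // w /co; apply: connect_sub => x y xy.
by rewrite connect1 // /join (subsetP BF').
Qed.

(** Counting vertices rather than components makes the total over all sizes equal to [#|T|] for
    every [F]. *)
Definition nverts (I : pred nat) F : nat :=
  (\sum_(S in components F | I #|S|) #|S|)%N.

Lemma nvertsT F : nverts predT F = #|T|.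
Proof.
rewrite /nverts -cardsT (card_partition (components_partition F)).
by apply: eq_bigl => S; rewrite andbT.
Qed.

Lemma nvertsU (I J K : pred nat) F : (forall k, K k -> I k || J k) ->
  (nverts K F <= nverts I F + nverts J F)%N.
Proof.
move=> IJK; rewrite /nverts !big_mkcondr -big_split /=; apply: leq_sum => S _.
by case: (K _) (IJK #|S|) => // /(_ isT); case: (I _); case: (J _) => //=; lia.
Qed.

Lemma nverts_le (I : pred nat) F : (nverts I F <= #|T|)%N.
Proof.
rewrite -(nvertsT F) /nverts !big_mkcondr; apply: leq_sum => S _.
by case: (I _).
Qed.

Lemma component_le_nverts (I : pred nat) F S : S \in components F -> I #|S| ->
  (#|S| <= nverts I F)%N.
Proof.
by move=> SF IS; rewrite /nverts (bigD1 S) ?SF //= leq_addr.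
Qed.

Lemma nvertsE (I : pred nat) F : nverts I F = #|[set v | I #|cc F v|]|.
Proof.
rewrite [RHS](_ : _ = \sum_(v in [set: T]) if I #|cc F v| then 1 else 0)%N; last first.
  by rewrite -sum1dep_card big_mkcond; apply: eq_bigl => v; rewrite inE.
rewrite (set_partition_big _ (components_partition F)) /nverts big_mkcondr.
apply: eq_bigr => S SF.
rewrite [RHS](eq_bigr (fun=> if I #|S| then 1 else 0)%N); last first.
  by move=> v vS; rewrite -(component_cc SF vS).
by case: (I _); rewrite ?sum1_card ?big1_eq.
Qed.

End Components.

(** * Comparing component probabilities at two densities *)

Section RegularGraph.
Variables (R : realType) (T : finType) (adj : rel T) (d : nat).
Hypotheses (adj_sym : symmetric adj)
  (adj_reg : forall v, #|neighbors adj v| = d).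
Implicit Types (F : {set {set T}}) (S : {set T}) (p : R).

(** Density 0 off the edges turns the random subgraph into a product measure on all sets of vertex
    sets. *)
Definition edgep p (e : {set T}) : R := if e \in edges adj then p else 0.

Lemma edgep_prob p : 0 <= p <= 1 -> is_prob (edgep p).
Proof. by move=> p01 e; rewrite /edgep; case: ifP => //; rewrite lexx ler01. Qed.

Lemma wt_edgep p F :
  wt (edgep p) F =
  if F \subset edges adj then p ^+ #|F| * (1 - p) ^+ #|edges adj :\: F| else 0.
Proof.
case: ifP => [FE|/negbT/subsetPn[e eF eE]]; last first.
  by rewrite /wt (bigD1 e) //= eF /edgep (negbTE eE) mul0r.
rewrite /wt (bigID (mem F)) /=; congr (_ * _).
  rewrite -prodr_const; apply: eq_bigr => e eF.
  by rewrite eF /edgep (subsetP FE).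
rewrite -prodr_const (bigID (mem (edges adj))) /= [X in _ * X]big1 ?mulr1.
  apply: eq_big => [e|e /andP[eF eE]]; first by rewrite inE.
  by rewrite (negbTE eF) /edgep eE.
by move=> e /andP[eF eE]; rewrite (negbTE eF) /edgep (negbTE eE) /= subr0.
Qed.

Lemma subgraph_probE p (A : pred {set {set T}}) :
  subgraph_prob adj p A = prob (edgep p) A.
Proof.
rewrite /subgraph_prob /prob /expect [RHS](bigID (mem (powerset (edges adj)))) /=.
rewrite [X in _ = _ + X]big1 ?addr0; last first.
  by move=> F; rewrite inE wt_edgep => /negbTE ->; rewrite mul0r.
rewrite [LHS]big_mkcondr /=; apply: eq_bigr => F; rewrite inE wt_edgep => ->.
by case: (A F); rewrite ?mulr1 ?mulr0.
Qed.

(** A change of measure at a single outcome: the likelihood ratio [r] has to be right only for the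
    given [F]. *)
Lemma wt_ratio (E : finType) (p q : E -> R) (r : E -> bool -> R) (F : {set E}) :
  (forall e, bern (p e) (e \in F) = bern (q e) (e \in F) * r e (e \in F)) ->
  wt p F = wt q F * \prod_e r e (e \in F).
Proof. by move=> H; rewrite /wt -big_split; apply: eq_bigr. Qed.

(** Pairs are ordered: in a loopless symmetric graph [npairs S S] is twice the number of edges
    inside [S], while [npairs S (~: S)] is the size of the edge boundary. *)
Definition npairs (S S' : {set T}) : nat :=
  #|[set x : T * T | [&& x.1 \in S, x.2 \in S' & adj x.1 x.2]]|.

Definition cross (S S' : {set T}) : {set {set T}} :=
  [set [set x.1; x.2] | x in [set x : T * T | [&& x.1 \in S, x.2 \in S' & adj x.1 x.2]]].

Lemma card_cross S S' : [disjoint S & S'] -> #|cross S S'| = npairs S S'.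
Proof.
move=> SS'; rewrite card_in_imset // => -[a b] [a' b']; rewrite !inE /=.
move=> /and3P[aS bS' _] /and3P[a'S b'S' _] /setP eq.
have : a \in [set a'; b'] by rewrite -eq !inE eqxx.
rewrite !inE => /orP[/eqP aa|/eqP ab]; last first.
  by move: (disjointFr SS' aS); rewrite ab b'S'.
have : b \in [set a'; b'] by rewrite -eq !inE eqxx orbT.
rewrite !inE => /orP[/eqP ba|/eqP ->]; last by rewrite aa.
by move: (disjointFl SS' bS'); rewrite ba a'S.
Qed.

Lemma crossP S S' e : reflect (exists u w, [/\ u \in S, w \in S', adj u w &
  e = [set u; w]]) (e \in cross S S').
Proof.
apply: (iffP imsetP) => [[[u w]]|[u [w [uS wS' uw ->]]]].
  by rewrite inE => /and3P[/= uS wS' uw] ->; exists u, w.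
by exists (u, w); rewrite // inE uS wS'.
Qed.

Lemma cross_edges S S' : cross S S' \subset edges adj.
Proof.
apply/subsetP => e /crossP[u [w [uS wS' uw ->]]].
by apply/imsetP; exists (u, w); rewrite ?inE.
Qed.

Lemma npairsT S : npairs S [set: T] = (#|S| * d)%N.
Proof.
rewrite /npairs -sum1_card (eq_bigl (fun x => (x.1 \in S) && adj x.1 x.2)).
  rewrite -(pair_big_dep (mem S) adj (fun _ _ => 1%N)) /=.
  rewrite -sum_nat_const; apply: eq_bigr => u _; rewrite sum1_card -(adj_reg u).
  by apply: eq_card => w; rewrite !inE.
by move=> x; rewrite !inE.
Qed.

Lemma npairsC S S' : (npairs S S' + npairs S (~: S'))%N = npairs S [set: T].
Proof.
rewrite /npairs -(cardsID [set x | x.2 \in S'] [set x | [&& x.1 \in S, x.2 \in [set: T] & adj x.1 x.2]]).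
congr (_ + _)%N; apply: eq_card => x; rewrite !inE /=;
  by case: (x.1 \in S); case: (x.2 \in S'); case: (adj _ _).
Qed.

Lemma npairs_le S S' : (npairs S S' <= #|S| * #|S'|)%N.
Proof.
rewrite -cardsX; apply/subset_leq_card/subsetP => x.
by rewrite !inE => /and3P[-> ->].
Qed.

Lemma card_touching_edges S : (#|edges adj :&: touching S| <= #|S| * d)%N.
Proof.
rewrite -npairsT; suff sub : edges adj :&: touching S \subset cross S [set: T].
  exact: leq_trans (subset_leq_card sub) (leq_imset_card _ _).
apply/subsetP => e; rewrite in_setI => /andP[/imsetP[[u w]]].
rewrite inE /= => uw ->; rewrite touching2 => /orP[uS|wS]; apply/crossP.
  by exists u, w; rewrite inE.
by exists w, u; rewrite inE adj_sym setUC.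
Qed.

Lemma component_no_cross F S : S \in components F ->
  [disjoint cross S (~: S) & F].
Proof.
move=> SF; rewrite -setI_eq0; apply/eqP/setP => e; rewrite !inE.
apply/negP => /andP[/crossP[u [w [uS wS uw ->]]] eF].
by move: wS; rewrite inE (component_closed SF uS eF).
Qed.

(* A component on k vertices uses at least k-1 of the at most kd edges touching
   it, so raising the edge probability from q to p changes its probability by at
   least this factor. *)
Lemma component_prob_ge (q p : R) S : 0 < q -> q <= p -> p < 1 ->
  prob (edgep q) (fun F => S \in components F) *
    ((p / q) ^+ #|S|.-1 * ((1 - p) / (1 - q)) ^+ (#|S| * d)) <=
  prob (edgep p) (fun F => S \in components F).
Proof.
move=> q0 qp p1; set a := p / q; set b := (1 - p) / (1 - q).
have q1 : q < 1 by exact: le_lt_trans p1.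
have a1 : 1 <= a by rewrite ler_pdivlMr // mul1r.
have b0 : 0 < b by rewrite divr_gt0 // subr_gt0.
have b1 : b <= 1 by rewrite ler_pdivrMr ?subr_gt0 // mul1r lerD2l lerN2.
(* Only the pairs touching [S] decide the event, so the density is changed there alone and the
   likelihood ratio involves no other edge. *)
pose m e : R := if e \in touching S then edgep q e else edgep p e.
have m01 : is_prob m.
  by move=> e; rewrite /m; case: ifP => _; apply: edgep_prob; lra.
rewrite (@prob_determined _ _ (touching S) (edgep q) m); last 2 first.
- exact: component_determined.
- by move=> e eS; rewrite /m eS.
rewrite mulrC -expectZ; apply: ler_sum => F _.
case: (boolP (S \in components F)) => SF; last by rewrite !mulr0.
rewrite !mulr1.
case: (boolP (F \subset edges adj)) => FE; last first.
  have /subsetPn[e eF eE] := FE.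
  have -> : wt m F = 0.
    by rewrite /wt (bigD1 e) //= eF /m /edgep (negbTE eE) if_same mul0r.
  by rewrite mul0r wt_ge0 //; apply: edgep_prob; lra.
pose B := edges adj :&: touching S.
rewrite (@wt_ratio _ (edgep p) m (fun e b' => if e \in B then if b' then a else b else 1)); last first.
  move=> e; rewrite in_setI /m /edgep.
  case: (e \in touching S); case: (e \in edges adj) => /=; rewrite ?mulr1 //.
  by case: (e \in F); rewrite /a /b /=; field; lra.
rewrite ler_wpM2l ?wt_ge0 //.
rewrite -big_mkcond /= (bigID (mem F)) /=.
rewrite (eq_bigr (fun=> a)); last by move=> e /andP[_ ->].
rewrite [X in _ <= _ * X](eq_bigr (fun=> b)); last by move=> e /andP[_ /negbTE->].
rewrite !prodr_const.
apply: ler_pM; [by rewrite exprn_ge0 ?(le_trans ler01)|by rewrite exprn_ge0 ?ltW| |].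
- apply: ler_weXn2l => //.
  have [B0 [B0F cB0 B0S] _] := spanning_tree SF.
  rewrite -cB0 /=; apply/subset_leq_card/subsetP => e eB0.
  have eE : e \in edges adj by rewrite (subsetP FE) // (subsetP B0F).
  rewrite unfold_in /= (subsetP B0F) // andbT in_setI eE /=.
  have /imsetP[[u w] _ def_e] := eE.
  have := B0S _ eB0; rewrite def_e subUset !sub1set => /andP[uS _].
  by rewrite touching2 uS.
- apply: ler_wiXn2l => //; first exact: ltW.
  apply: leq_trans (card_touching_edges S).
  by apply: subset_leq_card; apply/subsetP => e; rewrite unfold_in /= => /andP[].
Qed.

(* Thinning the edges inside a component from density p to density q keeps a
   spanning tree with probability at least (q / p)^(k-1), while the edges leaving
   the component only enter through the probability that all are absent. *)
Lemma component_prob_le (q p : R) S : 0 < q -> q <= p -> p < 1 ->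
  prob (edgep p) (fun F => S \in components F) <=
  (p / q) ^+ #|S|.-1 * ((1 - p) / (1 - q)) ^+ npairs S (~: S) *
  prob (edgep q) (fun F => S \in components F).
Proof.
move=> q0 qp p1; set a := p / q; set b := (1 - p) / (1 - q).
have q1 : q < 1 by exact: le_lt_trans p1.
have p0 : 0 < p by exact: lt_le_trans qp.
have b0 : 0 < b by rewrite divr_gt0 // subr_gt0.
pose D := cross S (~: S).
have SSC : [disjoint S & ~: S] by rewrite -setI_eq0 setICr.
pose m e : R := if e \in D then q else edgep p e.
have m01 : is_prob m.
  by move=> e; rewrite /m; case: ifP => _; [lra|apply: edgep_prob; lra].
(* On the event all boundary edges are absent, so changing their density from [q] to [p] costs
   exactly a factor [b] per edge. *)
have -> : prob (edgep p) (fun F => S \in components F) =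
    b ^+ npairs S (~: S) * prob m (fun F => S \in components F).
  rewrite -expectZ; apply: eq_bigr => F _; case: (boolP (S \in components F)) => SF; last by rewrite !mulr0.
  rewrite !mulr1 (@wt_ratio _ (edgep p) m (fun e b' => if e \in D then b else 1)).
    by rewrite -big_mkcond prodr_const card_cross.
  move=> e; rewrite /m; case: (boolP (e \in D)) => eD; last by rewrite mulr1.
  rewrite (disjointFr (component_no_cross SF) eD) /edgep (subsetP (cross_edges _ _) _ eD).
  by rewrite /b /=; field; lra.
rewrite [a ^+ _ * _]mulrC -mulrA.
apply: ler_wpM2l; first by rewrite exprn_ge0 // ltW.
have a0 : 0 < a by rewrite divr_gt0.
rewrite -ler_pdivrMl ?exprn_gt0 // -exprVn -expectZ.
(* Thinning [m] by [t] gives density [q] on every edge; boundary edges have it already and are all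
   kept. *)
pose t e : R := if e \in D then 1 else q / p.
have qp01 : 0 < q / p <= 1 by rewrite divr_gt0 //= ler_pdivrMr // mul1r.
have t01 : is_prob t by move=> e; rewrite /t; case: ifP => _; lra.
rewrite [leRHS](_ : _ = expect (fun e => m e * t e) (fun F => (S \in components F)%:R)); last first.
  apply: eq_expectp => e; rewrite /m /t /edgep.
  case: (boolP (e \in D)) => eD; first by rewrite (subsetP (cross_edges _ _) _ eD) mulr1.
  by case: ifP => _; rewrite ?mul0r //; field; lra.
rewrite -expect_thin; apply: ler_expect => // F.
case: (boolP (S \in components F)) => SF; last first.
  by rewrite mulr0; apply: expect_ge0.
rewrite mulr1; have [B [BF cB BS] Bco] := spanning_tree SF.
apply: (@le_trans _ _ (prob t (fun Q => B \subset Q))).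
  rewrite prob_subset -cB /= -prodr_const.
  apply: ler_prod => e _; rewrite /a invf_div /t; case: ifP => _; lra.
apply: ler_prob => // Q BQ; apply: Bco => [|u w uS].
  by apply/subsetP => e eB; rewrite inE (subsetP BF) // (subsetP BQ).
by rewrite inE => /andP[uw _]; exact: component_closed uw.
Qed.

End RegularGraph.

(** * Counting vertices by component size *)

Section Counting.
Variables (R : realType) (T : finType) (adj : rel T).
Implicit Types (F : {set {set T}}) (S : {set T}) (p : R) (I : pred nat).

Local Notation compp p S := (prob (edgep adj p) (fun F => S \in components F)).
Local Notation mean p I := (expect (edgep adj p) (fun F => (nverts I F)%:R)).

Lemma nverts_sum I F :
  (nverts I F)%:R = \sum_(S : {set T} | I #|S|) #|S|%:R * (S \in components F)%:R :> R.
Proof.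
rewrite /nverts natr_sum big_mkcondl; apply: eq_bigr => S _.
by case: (S \in _); rewrite ?mulr1 ?mulr0.
Qed.

Lemma mean_sum p I :
  mean p I = \sum_(S : {set T} | I #|S|) #|S|%:R * compp p S.
Proof.
under eq_expect do rewrite nverts_sum.
by rewrite expect_sum; apply: eq_bigr => S _; rewrite expectZ.
Qed.

Lemma mean_le p I : 0 <= p <= 1 -> mean p I <= #|T|%:R.
Proof.
move=> p01; rewrite -[leRHS](expect_cst (edgep adj p)).
by apply: ler_expect => [|F]; rewrite ?ler_nat ?nverts_le //; exact: edgep_prob.
Qed.

Lemma meanT p : mean p predT = #|T|%:R.
Proof. by under eq_expect do rewrite nvertsT; rewrite expect_cst. Qed.

Lemma mean_le_mul p q I (c : R) :
  (forall S, (0 < #|S|)%N -> I #|S| -> compp p S <= c * compp q S) ->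
  mean p I <= c * mean q I.
Proof.
move=> H; rewrite !mean_sum mulr_sumr; apply: ler_sum => S IS.
have [->|S0] := posnP #|S|; first by rewrite !mul0r mulr0.
by rewrite mulrCA ler_wpM2l ?H.
Qed.

Lemma mean_ge_mul p q I (c : R) :
  (forall S, (0 < #|S|)%N -> I #|S| -> c * compp q S <= compp p S) ->
  c * mean q I <= mean p I.
Proof.
move=> H; rewrite !mean_sum mulr_sumr; apply: ler_sum => S IS.
have [->|S0] := posnP #|S|; first by rewrite !mul0r mulr0.
by rewrite mulrCA ler_wpM2l ?H.
Qed.

Lemma prob_exists_component_le p I : 0 <= p <= 1 ->
  prob (edgep adj p) (fun F => [exists S in components F, I #|S|]) <= mean p I.
Proof.
move=> p01; rewrite -[leLHS]mul1r; apply: finite_markov => //; first exact: edgep_prob.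
move=> F /exists_inP[S SF IS]; rewrite ler1n.
apply: leq_trans (component_le_nverts SF IS).
by have [v vS] := component_n0 SF; apply/card_gt0P; exists v.
Qed.

(** If [S] is a component, then [S'] is one exactly when it is one after deletion of everything
    touching [S], which is an independent event. Conversely, this event and the absence of the at
    most [#|S| * #|S'|] edges between the two sets make [S'] a component. *)
Lemma prob_two_components p S S' : 0 <= p <= 1 -> [disjoint S & S'] ->
  prob (edgep adj p) (fun F => (S \in components F) && (S' \in components F)) *
    (1 - p) ^+ (#|S| * #|S'|) <= compp p S * compp p S'.
Proof.
move=> p01 SS'; pose B := touching S; have ep := edgep_prob adj p01.
pose X := [set [set x.1; x.2] | x in setX S S'].
have step1 : prob (edgep adj p) (fun F => (S \in components F) && (S' \in components F))
   <= compp p S * prob (edgep adj p) (fun F => S' \in components (F :\: B)).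
  rewrite -(@prob_indep _ _ B); first last.
  - by move=> F F'; rewrite !setDE => ->.
  - exact: component_determined.
  apply: ler_prob => // F /andP[SF S'F]; rewrite SF /=.
  apply: (component_local S'F) => u w uS'; rewrite in_setD touching2 negb_or.
  case: (boolP (_ \in F)) => uw; rewrite ?andbF // andbT.
  rewrite (disjointFl SS' uS') (disjointFl SS') //.
  exact: component_closed S'F uS' uw.
have step2 : (1 - p) ^+ (#|S| * #|S'|) * prob (edgep adj p) (fun F => S' \in components (F :\: B))
    <= compp p S'.
  apply: (@le_trans _ _ (prob (edgep adj p) (fun F => [disjoint X & F] && (S' \in components (F :\: B))))).
    rewrite (@prob_indep _ _ B); first last.
    - by move=> F F'; rewrite !setDE => ->.
    - move=> F F' FF'; rewrite -!setI_eq0.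
      have XB : X = X :&: B.
        apply/esym/setIidPl/subsetP => e /imsetP[[u w]]; rewrite inE => /andP[/= uS _] ->.
        by rewrite touching2 uS.
      by rewrite XB -setIA [B :&: F]setIC FF' -setIA [B :&: F']setIC.
    rewrite ler_wpM2r ?prob_ge0 // prob_disjoint.
    apply: (@le_trans _ _ (\prod_(e in X) (1 - p))).
      rewrite prodr_const -cardsX; apply: ler_wiXn2l; [lra|lra|exact: leq_imset_card].
    apply: ler_prod => e _; rewrite /edgep; case: ifP => _; lra.
  apply: ler_prob => // F /andP[XF S'F].
  apply: (component_local S'F) => u w uS'; rewrite in_setD touching2.
  case: (boolP (_ \in F)) => uw; rewrite ?andbF // andbT.
  rewrite (disjointFl SS' uS') /=; apply/negP => wS.
  suff : [set u; w] \in X by move=> /(disjointFr XF); rewrite uw.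
  by apply/imsetP; exists (w, u); rewrite ?inE ?wS // setUC.
apply: le_trans (ler_wpM2r _ step1) _; first by rewrite exprn_ge0; lra.
rewrite -mulrA ler_wpM2l ?prob_ge0 // mulrC; exact: step2.
Qed.

(** Distinct components are disjoint and hence almost independent; the diagonal contributes at most
    [K] times the mean. *)
Lemma second_moment p I (K : nat) : 0 <= p < 1 -> (forall k, I k -> (k <= K)%N) ->
  expect (edgep adj p) (fun F => (nverts I F)%:R ^+ 2) <=
  (mean p I) ^+ 2 / (1 - p) ^+ (K * K) + K%:R * mean p I.
Proof.
move=> /andP[p0 p1] IK; have p01 : 0 <= p <= 1 by rewrite p0 ltW.
have ep := edgep_prob adj p01.
pose two S S' := prob (edgep adj p) (fun F => (S \in components F) && (S' \in components F)).
have -> : expect (edgep adj p) (fun F => (nverts I F)%:R ^+ 2) =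
   \sum_(S : {set T} | I #|S|) \sum_(S' : {set T} | I #|S'|) #|S|%:R * #|S'|%:R * two S S'.
  under eq_expect do rewrite expr2 !nverts_sum mulr_suml.
  rewrite expect_sum; apply: eq_bigr => S _.
  under eq_expect do rewrite mulr_sumr.
  rewrite expect_sum; apply: eq_bigr => S' _; rewrite -expectZ.
  by apply: eq_expect => F; rewrite -mulnb natrM mulrACA.
apply: (@le_trans _ _ (\sum_(S : {set T} | I #|S|) \sum_(S' : {set T} | I #|S'|)
   (#|S|%:R * compp p S * (#|S'|%:R * compp p S') / (1 - p) ^+ (K * K) +
     (if S' == S then K%:R * (#|S|%:R * compp p S) else 0)))).
  apply: ler_sum => S IS; apply: ler_sum => S' IS'.
  have q0 : 0 < (1 - p) ^+ (K * K) by rewrite exprn_gt0 // subr_gt0.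
  have c0 U : 0 <= compp p U by exact: prob_ge0.
  case: eqP => [->|/eqP neq].
    rewrite -[leLHS]add0r lerD //.
      by rewrite divr_ge0 ?mulr_ge0 // ltW.
    rewrite mulrA /two ler_pM // ?mulr_ge0 ?prob_ge0 //.
      by rewrite ler_wpM2r // ler_nat IK.
    by apply: ler_prob => // F /andP[].
  rewrite addr0 [X in X / _]mulrACA -[leRHS]mulrA ler_wpM2l ?mulr_ge0 //.
  case: (boolP [disjoint S & S']) => SS'; last first.
    rewrite /two (eq_prob _ (A' := pred0)).
      by rewrite prob_pred0 divr_ge0 ?mulr_ge0 // ltW.
    move=> F /=; apply/negP => /andP[SF S'F].
    by rewrite (components_disjoint SF S'F) // eq_sym in SS'.
  rewrite ler_pdivlMr //; apply: le_trans (prob_two_components p01 SS').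
  rewrite ler_wpM2l ?prob_ge0 //; apply: ler_wiXn2l; [lra|lra|].
  by rewrite leq_mul ?IK.
rewrite le_eqVlt; apply/orP; left; apply/eqP.
under eq_bigr do rewrite big_split /=.
rewrite big_split /=; congr (_ + _).
  rewrite mean_sum expr2 mulr_suml mulr_suml; apply: eq_bigr => S _.
  by rewrite [X in _ = X / _]mulr_sumr [RHS]mulr_suml.
rewrite mean_sum mulr_sumr; apply: eq_bigr => S IS.
rewrite -big_mkcondr /= (big_pred1 S) // => S' /=.
by case: eqP => [->|]; rewrite ?andbF ?IS.
Qed.

(** The graph is a union of two independent rounds. If the first puts at least [m] vertices into
    components above [b] and no component reaches [m] in the end, then the second round misses every
    edge between some two of these components. *)
Lemma sprinkling p p1 p2 (m b c : R) :
  0 <= p1 <= 1 -> 0 <= p2 <= 1 -> 1 - p = (1 - p1) * (1 - p2) -> 0 < m -> 0 <= c ->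
  (forall S S' : {set T}, [disjoint S & S'] -> b < #|S|%:R -> b < #|S'|%:R ->
     (1 - p2) ^+ npairs adj S S' <= c) ->
  prob (edgep adj p) (fun F => [forall L in components F, #|L|%:R < m]) <=
  prob (edgep adj p1) (fun F => #|T|%:R - (nverts (fun k => k%:R <= b) F)%:R < m)
  + #|T|%:R ^+ 2 * c.
Proof.
move=> p101 p201 pE m_gt0 c_ge0 mixing.
have ep1 := edgep_prob adj p101; have ep2 := edgep_prob adj p201.
have c0 : 0 <= #|T|%:R ^+ 2 * c by rewrite mulr_ge0 // exprn_ge0.
pose bad F := [forall L in components F, #|L|%:R < m].
rewrite {1}/prob.
rewrite (@eq_expectp _ _ _ (fun e => 1 - (1 - edgep adj p1 e) * (1 - edgep adj p2 e))); last first.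
  by move=> e; rewrite /edgep; case: ifP => _; [rewrite -pE; ring|ring].
rewrite -expect_sprinkle -[X in _ + X](expect_cst (edgep adj p1)) -expectD.
apply: ler_expect => // F1.
case: (boolP (_ < m)) => [_|]; rewrite ?add0r.
  apply: (@le_trans _ _ 1); last by rewrite lerDl.
  by rewrite -[leRHS](expect_cst (edgep adj p2)); apply: ler_expect => // F; case: [forall _ in _, _].
rewrite -leNgt => mY.
pose big v := b < #|cc F1 v|%:R.
(* Components are indexed by their vertices, so the union bound has [#|T| ^ 2] terms whatever [F1]
   is. *)
pose sep (x : T * T) F2 := [&& big x.1, big x.2, cc F1 x.1 != cc F1 x.2 &
  [disjoint cross adj (cc F1 x.1) (cc F1 x.2) & F2]].
apply: (@le_trans _ _ (expect (edgep adj p2) (fun F2 => \sum_(x : T * T) (sep x F2)%:R))).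
  apply: ler_expect => // F2; rewrite -natr_sum ler_nat.
  case: (boolP [forall L in _, _]) => // /forall_inP badF.
  (* Otherwise the second round joins all components above [b] into one, of size at least [m]. *)
  suff [x sx] : exists x, sep x F2 by rewrite (bigD1 x) //= sx.
  apply/existsP; rewrite -[X in is_true X]negbK negb_exists; apply/negP => /forallP nsep.
  have YE : #|T|%:R - (nverts (fun k => k%:R <= b) F1)%:R = #|[set v | big v]|%:R :> R.
    rewrite nvertsE -[#|T|](cardsC [set v | big v]) natrD.
    rewrite [X in _ + _ - X](_ : _ = #|~: [set v | big v]|%:R) ?addrK //.
    by congr (_%:R); apply: eq_card => v; rewrite !inE /big -leNgt.
  rewrite {}YE in mY.
  have /card_gt0P[v] : (0 < #|[set v | big v]|)%N.
    by rewrite -(ltr0n R) (lt_le_trans m_gt0).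
  rewrite inE => bv; have := badF _ (cc_components (F1 :|: F2) v).
  apply/negP; rewrite -leNgt (le_trans mY) // ler_nat.
  apply/subset_leq_card/subsetP => w; rewrite inE => bw.
  have sub1 : subrel (connect (join F1)) (connect (join (F1 :|: F2))).
    by apply: connect_sub => x y xy; rewrite connect1 // /join in_setU [_ \in F1]xy.
  rewrite inE; case: (eqVneq (cc F1 v) (cc F1 w)) => [vw|vw].
    by apply: sub1; have := in_cc F1 w; rewrite -vw inE.
  have := nsep (v, w); rewrite /sep /= bv bw vw /= -setI_eq0 => /set0Pn[e].
  rewrite in_setI => /andP[/crossP[x [y [xv yw _ ->]]] eF].
  apply: (@connect_trans _ _ x); first by apply: sub1; rewrite inE in xv.
  apply: (@connect_trans _ _ y); first by rewrite connect1 // /join in_setU eF orbT.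
  by apply: sub1; rewrite (join_connect_sym F1); rewrite inE in yw.
rewrite expect_sum.
rewrite -natrX -mulnn -card_prod mulr_natl -sumr_const.
apply: ler_sum => -[u v] _; rewrite -[expect _ _]/(prob _ (sep (u, v))).
case: (boolP [&& big u, big v & cc F1 u != cc F1 v]) => [/and3P[bu bv uv]|nb]; last first.
  rewrite (eq_prob _ (A' := pred0)); first by rewrite prob_pred0.
  move=> F /=; apply/negP => /and4P[/= bu bv uv _].
  by rewrite bu bv uv in nb.
have dis := components_disjoint (cc_components F1 u) (cc_components F1 v) uv.
apply: (@le_trans _ _ (prob (edgep adj p2) (fun F2 => [disjoint cross adj (cc F1 u) (cc F1 v) & F2]))).
  by apply: ler_prob => // F /and4P[].
rewrite prob_disjoint (eq_bigr (fun=> 1 - p2)); last first.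
  by move=> e ecr; rewrite /edgep (subsetP (cross_edges _ _ _)  _ ecr).
by rewrite prodr_const card_cross //; exact: mixing.
Qed.

End Counting.

(** * Expander mixing *)

Section Spectral.
Variables (R : realType) (T : finType) (adj : rel T) (d : nat).
Hypotheses (adj_sym : symmetric adj)
  (adj_reg : forall v, #|neighbors adj v| = d).
Implicit Types (f g : T -> R).

Definition dot f g : R := \sum_v f v * g v.

Definition adjop f (v : T) : R := \sum_(w | adj v w) f w.

Lemma sum_mem (U : {set T}) : \sum_v (v \in U)%:R = #|U|%:R :> R.
Proof.
rewrite -sum1_card natr_sum [RHS]big_mkcond; apply: eq_bigr => v _.
by case: (v \in U).
Qed.

Lemma sum_constT (c : R) : \sum_(v : T) c = c * #|T|%:R.
Proof. by rewrite sumr_const mulr_natr. Qed.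

Lemma dot_ge0 f : 0 <= dot f f.
Proof. by apply: sumr_ge0 => v _; rewrite -expr2 sqr_ge0. Qed.

(** Lagrange's identity. *)
Lemma cauchy_schwarz f g : dot f g ^+ 2 <= dot f f * dot g g.
Proof.
suff : 0 <= (dot f f * dot g g - dot f g ^+ 2) *+ 2 by rewrite pmulrn_lge0 // subr_ge0.
have -> : (dot f f * dot g g - dot f g ^+ 2) *+ 2 =
    \sum_v \sum_w (f v * g w - f w * g v) ^+ 2.
  have -> : (dot f f * dot g g - dot f g ^+ 2) *+ 2 =
    dot f f * dot g g + dot g g * dot f f - (dot f g * dot f g) *+ 2.
    by rewrite !mulr2n; ring.
  rewrite /dot !big_distrlr /= -sumrMnl -big_split -sumrB; apply: eq_bigr => v _ /=.
  rewrite -sumrMnl -big_split -sumrB; apply: eq_bigr => w _ /=.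
  by rewrite !mulr2n; ring.
by apply: sumr_ge0 => v _; apply: sumr_ge0 => w _; exact: sqr_ge0.
Qed.

Lemma adjop_sym f g : dot (adjop f) g = dot f (adjop g).
Proof.
rewrite /dot /adjop.
under eq_bigr do rewrite mulr_suml.
under [RHS]eq_bigr do rewrite mulr_sumr.
rewrite (exchange_big_dep predT) //=; apply: eq_bigr => v _.
by apply: eq_bigl => w; rewrite adj_sym.
Qed.

Lemma sum_adjop f : \sum_v adjop f v = d%:R * \sum_v f v.
Proof.
rewrite /adjop (exchange_big_dep predT) //= mulr_sumr; apply: eq_bigr => v _.
rewrite (eq_bigl (fun w => w \in neighbors adj v)).
  by rewrite sumr_const adj_reg mulr_natl.
by move=> w; rewrite inE adj_sym.
Qed.

(* Cauchy-Schwarz makes the squared norms of the iterates log-convex, so the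
   first growth ratio is at most the asymptotic one. *)
Lemma adjop_norm_le f (t C : R) : 0 < t ->
  (forall m v, `|iter m adjop f v| <= C * t ^+ m) ->
  dot (adjop f) (adjop f) <= t ^+ 2 * dot f f.
Proof.
move=> t0 bnd; pose a m := dot (iter m adjop f) (iter m adjop f).
rewrite -[dot f f]/(a 0%N) -[dot (adjop _) _]/(a 1%N) leNgt; apply/negP => lt1.
have a_ge0 m : 0 <= a m by exact: dot_ge0.
have conv m : a m.+1 ^+ 2 <= a m * a m.+2.
  by rewrite {1}/a {1}iterS adjop_sym -iterS cauchy_schwarz.
have a0 : 0 < a 0%N.
  rewrite lt_neqAle a_ge0 eq_sym andbT; apply/eqP => e.
  have := conv 0%N; rewrite e mul0r => h.
  have : a 1%N ^+ 2 == 0 by rewrite eq_le h sqr_ge0.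
  by rewrite sqrf_eq0 => /eqP e1; move: lt1; rewrite e e1 mulr0 ltxx.
pose s := a 1%N / a 0%N.
have s_gt : t ^+ 2 < s by rewrite ltr_pdivlMr.
have t20 : 0 < t ^+ 2 by rewrite exprn_gt0.
have s0 : 0 < s by lra.
have grow m : 0 < a m /\ s * a m <= a m.+1.
  elim: m => [|m [am IH]]; first by split=> //; rewrite /s divfK // gt_eqF.
  have am1 : 0 < a m.+1 by apply: lt_le_trans IH; rewrite mulr_gt0.
  split=> //; rewrite -(ler_pM2l am); apply: le_trans (conv m).
  by rewrite expr2 mulrA [a m * s]mulrC ler_pM2r.
have pow m : s ^+ m * a 0%N <= a m.
  elim: m => [|m IH]; first by rewrite mul1r.
  have [_] := grow m; apply: le_trans.
  by rewrite exprS -mulrA ler_pM2l.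
have upper m : a m <= #|T|%:R * C ^+ 2 * (t ^+ 2) ^+ m.
  have -> : #|T|%:R * C ^+ 2 * (t ^+ 2) ^+ m = \sum_(v : T) (C * t ^+ m) ^+ 2.
    by rewrite sumr_const [in RHS]exprMn -!exprM mulnC -mulrA mulr_natl.
  apply: ler_sum => v _; rewrite -expr2 -(real_normK (num_real _)).
  by rewrite lerXn2r ?nnegrE // (le_trans _ (bnd m v)).
pose x := s / t ^+ 2 - 1.
have x0 : 0 < x by rewrite subr_gt0 ltr_pdivlMr // mul1r.
(* Bernoulli's inequality: if the first growth ratio exceeded [t ^+ 2], the normalised norms would
   be unbounded, against [upper]. *)
have bern m : 1 + m%:R * x <= (s / t ^+ 2) ^+ m.
  elim: m => [|m IH]; first by rewrite mul0r addr0 expr0.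
  have sx : s / t ^+ 2 = 1 + x by rewrite /x addrC subrK.
  rewrite exprS; move: IH; rewrite sx => IH.
  have : (1 + x) * (1 + m%:R * x) <= (1 + x) * (1 + x) ^+ m.
    by rewrite ler_wpM2l //; lra.
  apply: le_trans; rewrite -natr1.
  have : 0 <= m%:R * x * x by rewrite !mulr_ge0 // ltW.
  lra.
pose B := #|T|%:R * C ^+ 2 / a 0%N.
have B0 : 0 <= B by rewrite divr_ge0 ?(ltW a0) // mulr_ge0 // exprn_even_ge0.
have bounded m : 1 + m%:R * x <= B.
  apply: (le_trans (bern m)); rewrite expr_div_n ler_pdivrMr ?exprn_gt0 //.
  rewrite /B mulrAC ler_pdivlMr //; exact: le_trans (pow m) (upper m).
have Bx : 0 <= B / x by rewrite divr_ge0 // ltW.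
have := bounded (Num.bound (B / x)); have := archi_boundP Bx.
rewrite ltr_pdivrMr //; lra.
Qed.

(** Constants are eigenvectors for [d], so centring the indicators subtracts exactly the number of
    pairs expected in a random-like graph. *)
Lemma npairs_dot (S S' : {set T}) : (0 < #|T|)%N ->
  dot (fun v => (v \in S)%:R - #|S|%:R / #|T|%:R)
      (adjop (fun v => (v \in S')%:R - #|S'|%:R / #|T|%:R)) =
  (npairs adj S S')%:R - d%:R * (#|S|%:R * #|S'|%:R / #|T|%:R).
Proof.
move=> T0; have N0 : #|T|%:R != 0 :> R by rewrite pnatr_eq0 -lt0n.
set g := adjop _.
have sg0 : \sum_v g v = 0.
  rewrite sum_adjop sumrB sum_constT sum_mem.
  by rewrite divfK // subrr mulr0.
rewrite /dot; under eq_bigr do rewrite mulrBl.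
rewrite sumrB -mulr_sumr sg0 mulr0 subr0.
have gE v : g v = #|[set w in S' | adj v w]|%:R - d%:R * (#|S'|%:R / #|T|%:R).
  rewrite /g /adjop sumrB; congr (_ - _).
    rewrite -natr_sum -sum1_card; congr (_%:R).
    rewrite big_mkcond [RHS]big_mkcond; apply: eq_bigr => w _.
    by rewrite inE; case: (adj v w); case: (w \in S').
  rewrite (eq_bigl (fun w => w \in neighbors adj v)); last by move=> w; rewrite inE.
  by rewrite sumr_const adj_reg [RHS]mulr_natl.
transitivity (\sum_(v in S) (#|[set w in S' | adj v w]|%:R - d%:R * (#|S'|%:R / #|T|%:R) : R)).
  rewrite [RHS]big_mkcond; apply: eq_bigr => v _; rewrite gE.
  by case: (v \in S); rewrite ?mul1r ?mul0r.
rewrite sumrB sumr_const -natr_sum; congr (_%:R - _); last first.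
  by rewrite -mulr_natl; ring.
rewrite /npairs -sum1_card.
rewrite (eq_bigl (fun x => (x.1 \in S) && ((x.2 \in S') && adj x.1 x.2))); last first.
  by move=> x; rewrite !inE.
rewrite -(pair_big_dep (mem S) (fun v w => (w \in S') && adj v w) (fun _ _ => 1%N)) /=.
apply: eq_bigr => v _; rewrite sum1_card; apply: eq_card => w.
by rewrite !inE.
Qed.

(** Cauchy-Schwarz for the centred indicators, whose squared norms are at most the sizes of the
    sets; the squared form avoids roots. *)
Lemma mixing_lemma (t : R) (S S' : {set T}) : (0 < #|T|)%N -> 0 <= t ->
  (forall f, \sum_v f v = 0 -> dot (adjop f) (adjop f) <= t ^+ 2 * dot f f) ->
  ((npairs adj S S')%:R - d%:R * (#|S|%:R * #|S'|%:R / #|T|%:R)) ^+ 2 <=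
  t ^+ 2 * (#|S|%:R * #|S'|%:R).
Proof.
move=> T0 t0 gap; have N0 : #|T|%:R != 0 :> R by rewrite pnatr_eq0 -lt0n.
rewrite -npairs_dot //.
have sum0 (U : {set T}) : \sum_v ((v \in U)%:R - #|U|%:R / #|T|%:R : R) = 0.
  rewrite sumrB sum_constT sum_mem.
  by rewrite divfK // subrr.
have norm (U : {set T}) : dot (fun v => (v \in U)%:R - #|U|%:R / #|T|%:R)
    (fun v => (v \in U)%:R - #|U|%:R / #|T|%:R) <= #|U|%:R.
  set c := _ / _; have c0 : 0 <= c by rewrite divr_ge0.
  have -> : dot (fun v => (v \in U)%:R - c) (fun v => (v \in U)%:R - c) =
     \sum_v ((v \in U)%:R - c *+ 2 * (v \in U)%:R + c ^+ 2).
    apply: eq_bigr => v _; case: (v \in U) => /=; rewrite mulr2n; ring.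
  rewrite big_split sumrB /= -mulr_sumr sum_constT sum_mem.
  rewrite expr2 -mulrA {3}/c divfK //.
  have : 0 <= c * #|U|%:R by rewrite mulr_ge0.
  by rewrite mulr2n; lra.
apply: le_trans (cauchy_schwarz _ _) _.
rewrite mulrCA; apply: ler_pM; rewrite ?dot_ge0 //.
apply: le_trans (gap _ (sum0 S')) _.
by rewrite ler_wpM2l ?sqr_ge0.
Qed.

End Spectral.

(** * The spectral gap of Johnson graphs *)

Section Johnson.
Variables (R : realType) (n r s : nat).
Hypotheses (sr : (s < r)%N) (rn : (r < n)%N).
Local Notation V := (johnson_vertex n r).
Local Notation adj := (@johnson_adj n r s).
Local Notation d := (degree adj).
Implicit Types (u v w : V) (f : V -> R) (a b : 'I_n).

Lemma johnson_regular v : #|neighbors adj v| = d.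
Proof.
have srn : (s < r <= n)%N by rewrite sr ltnW.
by rewrite (johnson_degreeE srn) (johnson_neighbors v sr).
Qed.

Lemma jswap_subproof a b v : (\sum_i [ffun i => val v (tperm a b i)] i)%N == r.
Proof.
rewrite (reindex_inj (@perm_inj _ (tperm a b))) /= -[X in _ == X](eqP (valP v)).
by apply/eqP/eq_bigr => i _; rewrite ffunE tpermK.
Qed.

Definition jswap a b v : V :=
  exist (fun v : {ffun 'I_n -> bool} => (\sum_i v i)%N == r) _ (jswap_subproof a b v).

Lemma jswapE a b v i : val (jswap a b v) i = val v (tperm a b i).
Proof. by rewrite /= ffunE. Qed.

Lemma jswapK a b : involutive (jswap a b).
Proof. by move=> v; apply/val_inj/ffunP => i; rewrite !jswapE tpermK. Qed.

Lemma jswap_id a b v : val v a = val v b -> jswap a b v = v.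
Proof.
by move=> ab; apply/val_inj/ffunP => i; rewrite jswapE; case: tpermP => [->|->|].
Qed.

Lemma adj_jswap a b u v : adj (jswap a b u) (jswap a b v) = adj u v.
Proof.
rewrite /johnson_adj (inj_eq (inv_inj (jswapK a b))); congr (_ && (_ == _)).
rewrite /inner_product (reindex_inj (@perm_inj _ (tperm a b))).
by apply: eq_bigr => i _; rewrite !jswapE tpermK.
Qed.

(** Lipschitz condition for the distance in which moving a single one is a unit step; [jswap a b]
    fixes [v] where the two coordinates agree. *)
Definition jlip f (L : R) := forall a b v, `|f (jswap a b v) - f v| <= L.

Definition nhits v a : nat := #|[set u | adj v u & val u a]|.

(** The transposition is then an automorphism fixing [v]. Hence [nhits v] takes one value on the
    ones of [v] and one on its zeros. *)
Lemma nhits_swap v a b : val v a = val v b -> nhits v a = nhits v b.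
Proof.
move=> ab; have vE w : adj v (jswap a b w) = adj v w.
  by rewrite -{1}(jswap_id ab) adj_jswap.
rewrite /nhits -(card_imset _ (inv_inj (jswapK a b))).
apply: eq_card => u; rewrite inE; apply/imsetP/andP => [[w + ->]|[vu ub]].
  by rewrite inE vE jswapE tpermR => /andP[].
by exists (jswap a b u); rewrite ?jswapK // inE vE vu jswapE tpermL.
Qed.

Lemma sum_nhits v (P : pred 'I_n) :
  (\sum_(a | P a) nhits v a = \sum_(u | adj v u) \sum_(a | P a) val u a)%N.
Proof.
rewrite exchange_big /=; apply: eq_bigr => a _.
rewrite /nhits -sum1_card big_mkcond [RHS]big_mkcond; apply: eq_bigr => u _.
by rewrite inE; case: (adj v u); case: (val u a).
Qed.

Lemma sum_vertex v : (\sum_a val v a = r)%N.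
Proof. exact/eqP/(valP v). Qed.

Lemma card_ones v : #|[pred a | val v a]| = r.
Proof.
rewrite -[RHS](sum_vertex v) -sum1_card big_mkcond; apply: eq_bigr => a _.
by rewrite inE; case: (val v a).
Qed.

Lemma card_zeros v : #|[pred a | ~~ val v a]| = (n - r)%N.
Proof.
have := cardC [pred a | val v a]; rewrite card_ones card_ord => e.
by rewrite -[in RHS]e addKn; apply: eq_card => a; rewrite !inE.
Qed.

(** Double counting: every neighbour shares [s] ones with [v], and by symmetry these are spread
    evenly over the [r] ones of [v]. *)
Lemma nhits_in v a : val v a -> (r * nhits v a = d * s)%N.
Proof.
move=> va; transitivity (\sum_(b | val v b) nhits v b)%N.
  rewrite (eq_bigr (fun=> nhits v a)); last first.
    by move=> b vb; apply: nhits_swap; rewrite va vb.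
  by rewrite (sum_nat_const [pred b | val v b]) card_ones.
rewrite sum_nhits -(johnson_regular v) -sum_nat_const.
rewrite (eq_bigl (mem (neighbors adj v))); last by move=> u; rewrite !inE.
apply: eq_bigr => u; rewrite !inE /johnson_adj => /andP[_ /eqP <-].
rewrite /inner_product big_mkcond; apply: eq_bigr => b _.
by case: (val v b); rewrite ?mul1n ?mul0n.
Qed.

Lemma nhits_out v a : ~~ val v a -> ((n - r) * nhits v a = d * (r - s))%N.
Proof.
move=> va; transitivity (\sum_(b | ~~ val v b) nhits v b)%N.
  rewrite (eq_bigr (fun=> nhits v a)); last first.
    by move=> b vb; apply: nhits_swap; rewrite (negbTE va) (negbTE vb).
  by rewrite (sum_nat_const [pred b | ~~ val v b]) card_zeros.
rewrite sum_nhits -(johnson_regular v) -sum_nat_const.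
rewrite (eq_bigl (mem (neighbors adj v))); last by move=> u; rewrite !inE.
apply: eq_bigr => u; rewrite !inE /johnson_adj => /andP[_ /eqP <-].
have := sum_vertex u; rewrite (bigID (fun b => val v b)) /=.
have -> : (\sum_(b | val v b) val u b = inner_product (val v) (val u))%N.
  rewrite big_mkcond; apply: eq_bigr => b _.
  by case: (val v b); rewrite ?mul1n ?mul0n.
by move=> /(congr1 (subn^~ (inner_product (val v) (val u)))); rewrite addKn.
Qed.

(** The fractions of neighbours of a vertex that contain a given one of it and a given zero of
    it. *)
Definition johnson_eps : R := s%:R / r%:R + (r - s)%:R / (n - r)%:R.

Lemma johnson_eps_gt0 : 0 < johnson_eps.
Proof.
rewrite ltr_wpDl ?divr_ge0 // divr_gt0 // ltr0n subn_gt0 //.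
Qed.

Lemma nhits_le v a b : val v a -> ~~ val v b ->
  (nhits v a + nhits v b)%:R = d%:R * johnson_eps :> R.
Proof.
move=> va vb; have r0 : (0 < r)%N by exact: leq_ltn_trans sr.
have e1 := congr1 (fun k => k%:R : R) (nhits_in va).
have e2 := congr1 (fun k => k%:R : R) (nhits_out vb).
rewrite !natrM in e1 e2; rewrite natrD /johnson_eps.
have r1 : r%:R != 0 :> R by rewrite pnatr_eq0 -lt0n.
have r2 : (n - r)%:R != 0 :> R by rewrite pnatr_eq0 -lt0n subn_gt0.
apply: (mulfI r1); apply: (mulfI r2).
transitivity ((n - r)%:R * (r%:R * (nhits v a)%:R) + r%:R * ((n - r)%:R * (nhits v b)%:R) : R); first ring.
by rewrite e1 e2; field; rewrite r1 r2.
Qed.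

(* Replacing v by its image under the transposition (a b) only moves those
   neighbours that contain exactly one of a and b, a fraction of at most
   s / r + (r - s) / (n - r). *)
Lemma jlip_adjop f L : 0 <= L -> jlip f L -> jlip (adjop adj f) (d%:R * johnson_eps * L).
Proof.
move=> L0 fL a b v.
have diffE : adjop adj f (jswap a b v) - adjop adj f v =
    \sum_(u | adj v u) (f (jswap a b u) - f u).
  rewrite sumrB; congr (_ - _).
  rewrite /adjop (reindex_inj (inv_inj (jswapK a b))) /=.
  by apply: eq_bigl => u; rewrite adj_jswap.
have de0 : 0 <= d%:R * johnson_eps by rewrite mulr_ge0 // ltW // johnson_eps_gt0.
have [ab|ab] := eqVneq (val v a) (val v b).
  by rewrite (jswap_id ab) subrr normr0 mulr_ge0.
have {}ab : (nhits v a + nhits v b)%:R = d%:R * johnson_eps :> R.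
  case va: (val v a) ab; case vb: (val v b) => // _.
    by apply: nhits_le; rewrite ?va ?vb.
  by rewrite addnC; apply: nhits_le; rewrite ?va ?vb.
rewrite diffE -ab; apply: le_trans (ler_norm_sum _ _ _) _.
apply: (@le_trans _ _ (\sum_(u | adj v u) (val u a + val u b)%N%:R * L)).
  apply: ler_sum => u _; case: (eqVneq (val u a) (val u b)) => [uab|].
    by rewrite (jswap_id uab) subrr normr0 mulr_ge0.
  by case: (val u a); case: (val u b) => // _; rewrite mul1r fL.
rewrite -mulr_suml ler_wpM2r // -natr_sum ler_nat /nhits.
rewrite big_split /= leq_add // -sum1_card big_mkcond [leqRHS]big_mkcond.
  by apply: leq_sum => u _; rewrite inE; case: (adj v u); case: (val u a).
by apply: leq_sum => u _; rewrite inE; case: (adj v u); case: (val u b).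
Qed.

(** Each swap of a one of [u] outside [v] with a zero of [u] inside [v] brings [u] closer to [v];
    both exist by equality of sizes. *)
Lemma jlip_diam f L u v : jlip f L -> `|f u - f v| <= n%:R * L.
Proof.
move=> fL; have L0 : 0 <= L.
  have i : 'I_n by exact: Ordinal rn.
  by apply: le_trans (fL i i u).
pose k u := #|[pred a | val u a && ~~ val v a]|.
suff ind m w : k w = m -> `|f w - f v| <= m%:R * L.
  apply: le_trans (ind _ u erefl) _; rewrite ler_wpM2r // ler_nat.
  by rewrite -[leqRHS]card_ord max_card.
elim: m w => {u} [|m IH] u ku.
  suff -> : u = v by rewrite subrr normr0 mul0r.
  have sub : [pred a | val u a] \subset [pred a | val v a].
    apply/subsetP => a; rewrite !inE => ua; apply/negPn/negP => va.
    by have /card0_eq/(_ a) := ku; rewrite !inE ua va.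
  have /subset_cardP eq : #|[pred a | val u a]| = #|[pred a | val v a]| by rewrite !card_ones.
  by apply/val_inj/ffunP => a; have := eq sub a; rewrite !inE.
have /card_gt0P[a] : (0 < k u)%N by rewrite ku.
rewrite inE => /andP[ua va].
have /existsP[b /andP[vb ub]] : [exists b, val v b && ~~ val u b].
  rewrite -[X in is_true X]negbK negb_exists; apply/negP => /forallP H.
  have sub : [pred a | val v a] \subset [pred a | val u a].
    by apply/subsetP => b; rewrite !inE => vb; have := H b; rewrite vb negbK.
  have /subset_cardP eq : #|[pred a | val v a]| = #|[pred a | val u a]| by rewrite !card_ones.
  by have := eq sub a; rewrite !inE ua (negbTE va).
have ab : a != b by apply: contraTneq ua => ->.
have kw : k (jswap a b u) = m.
  apply: succn_inj; rewrite -ku /k (cardD1 a [pred a | val u a && ~~ val v a]) !inE ua va /= add1n.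
  congr _.+1; apply: eq_card => c; rewrite !inE jswapE.
  case: tpermP => [->|->|/eqP ca /eqP cb]; rewrite ?eqxx ?vb ?(negbTE ub) ?andbF //.
  by rewrite ca.
have -> : f u - f v = (f (jswap a b u) - f v) + (f u - f (jswap a b u)) by ring.
rewrite -natr1 mulrDl mul1r; apply: le_trans (ler_normD _ _) _.
by apply: lerD; [exact: IH|rewrite distrC fL].
Qed.

(** The seminorm is blind to constants, but mean 0 is preserved by the operator and makes [f v] the
    average of the differences [f v - f u]. So the contraction bounds the values of all iterates. *)
Lemma johnson_gap f : (0 < d)%N -> \sum_v f v = 0 ->
  dot (adjop adj f) (adjop adj f) <= (d%:R * johnson_eps) ^+ 2 * dot f f.
Proof.
move=> d0 f0; set t := d%:R * johnson_eps.
have t0 : 0 < t by rewrite mulr_gt0 ?ltr0n ?johnson_eps_gt0.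
(* Any Lipschitz constant will do: [adjop_norm_le] retains only the rate [t]. *)
pose L := \sum_v `|f v| *+ 2.
have L0 : 0 <= L by apply: sumr_ge0 => v _; rewrite mulrn_wge0.
have fL : jlip f L.
  move=> a b v; apply: le_trans (ler_normB _ _) _.
  rewrite /L sumrMnl mulr2n lerD //.
    by rewrite (bigD1 (jswap a b v)) //= lerDl sumr_ge0.
  by rewrite (bigD1 v) //= lerDl sumr_ge0.
have iterL m : jlip (iter m (adjop adj) f) (L * t ^+ m) /\
    \sum_v iter m (adjop adj) f v = 0.
  elim: m => [|m [IH1 IH2]]; first by rewrite mulr1.
  split; last by rewrite iterS (sum_adjop (@johnson_adj_sym n r s) johnson_regular) IH2 mulr0.
  rewrite iterS exprS mulrCA; apply: jlip_adjop => //.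
  by rewrite mulr_ge0 // exprn_ge0 // ltW.
apply: (adjop_norm_le (@johnson_adj_sym n r s) (C := n%:R * L)) => // m v.
have [lip sum0] := iterL m; set g := iter m _ _ in lip sum0 *.
have V0 : 0 < #|{: V}|%:R :> R by rewrite ltr0n; apply/card_gt0P; exists v.
rewrite -(ler_pM2r V0).
have -> : `|g v| * #|{: V}|%:R = `|\sum_u (g v - g u)|.
  by rewrite sumrB sum0 subr0 sum_constT normrM normr_nat.
apply: le_trans (ler_norm_sum _ _ _) _; rewrite -sum_constT.
by apply: ler_sum => u _; rewrite -mulrA; exact: jlip_diam.
Qed.

Lemma johnson_mixing (S S' : {set V}) : (0 < d)%N ->
  ((npairs adj S S')%:R - d%:R * (#|S|%:R * #|S'|%:R / #|{: V}|%:R)) ^+ 2 <=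
  (d%:R * johnson_eps) ^+ 2 * (#|S|%:R * #|S'|%:R).
Proof.
move=> d0; apply: (mixing_lemma (@johnson_adj_sym n r s) johnson_regular).
- by rewrite johnson_card bin_gt0 ltnW.
- by rewrite mulr_ge0 // ltW // johnson_eps_gt0.
- by move=> f; exact: johnson_gap.
Qed.

End Johnson.

From mathcomp Require Import all_classical all_reals all_analysis.
Import numFieldNormedType.Exports.
Local Open Scope classical_set_scope.
Local Open Scope ring_scope.

(** * Asymptotics *)

Section RealBounds.
Variable R : realType.
Implicit Types x y t : R.

Lemma onem_le_expR t : 1 - t <= expR (- t).
Proof. exact: expR_ge1Dx. Qed.

Lemma onemV_le_expR t : t < 1 -> (1 - t)^-1 <= expR (t / (1 - t)).
Proof.
move=> t1; rewrite [leLHS](_ : _ = 1 + t / (1 - t)); first exact: expR_ge1Dx.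
by field; lra.
Qed.

Lemma ratio_le_expR x y (d : nat) : (0 < d)%N -> x < d%:R -> y < d%:R ->
  (1 - x / d%:R) / (1 - y / d%:R) <=
  expR ((y / (1 - y / d%:R) - x) / d%:R).
Proof.
move=> d0 xd yd; have dp : 0 < d%:R :> R by rewrite ltr0n.
have x1 : x / d%:R < 1 by rewrite ltr_pdivrMr // mul1r.
have y1 : y / d%:R < 1 by rewrite ltr_pdivrMr // mul1r.
apply: (@le_trans _ _ (expR (- (x / d%:R)) * expR (y / d%:R / (1 - y / d%:R)))).
  apply: ler_pM; [lra|by rewrite invr_ge0; lra|exact: onem_le_expR|].
  exact: onemV_le_expR.
rewrite -expRD ler_expR le_eqVlt; apply/orP; left; apply/eqP.
have y2 : d%:R - y != 0 by lra.
by field; lra.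
Qed.

Lemma ratio_exp_le x y (d : nat) : (0 < d)%N -> x < d%:R -> y < d%:R ->
  ((1 - x / d%:R) / (1 - y / d%:R)) ^+ d <= expR (y / (1 - y / d%:R) - x).
Proof.
move=> d0 xd yd; have dp : 0 < d%:R :> R by rewrite ltr0n.
have x1 : x / d%:R < 1 by rewrite ltr_pdivrMr // mul1r.
have y1 : y / d%:R < 1 by rewrite ltr_pdivrMr // mul1r.
rewrite [leRHS](_ : _ = expR ((y / (1 - y / d%:R) - x) / d%:R) ^+ d).
  rewrite lerXn2r ?nnegrE ?expR_ge0 ?ratio_le_expR //.
  by rewrite divr_ge0; lra.
by rewrite -expRM_natr divfK // gt_eqF.
Qed.

Lemma ratio_exp_ge x y (d : nat) : (0 < d)%N -> x < d%:R -> y < d%:R ->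
  expR (y - x / (1 - x / d%:R)) <= ((1 - x / d%:R) / (1 - y / d%:R)) ^+ d.
Proof.
move=> d0 xd yd; have dp : 0 < d%:R :> R by rewrite ltr0n.
have x1 : x / d%:R < 1 by rewrite ltr_pdivrMr // mul1r.
have y1 : y / d%:R < 1 by rewrite ltr_pdivrMr // mul1r.
(* Inverting the quotient exchanges the roles of [x] and [y] and reduces to the upper bound. *)
rewrite -[leRHS]invrK -exprVn invf_div -[leLHS]invrK -expRN opprB.
rewrite lef_pV2 ?posrE ?expR_gt0 ?exprn_gt0 ?divr_gt0; try lra.
exact: ratio_exp_le.
Qed.

Lemma exists_expR_le (g x : R) : 0 < g -> 0 < x ->
  exists K : nat, expR (- g * K%:R) <= x.
Proof.
move=> g0 x0; have gx : 0 <= (g * x)^-1 by rewrite invr_ge0 mulr_ge0 // ltW.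
exists (Num.bound (g * x)^-1); have := archi_boundP gx.
set K := (Num.bound _)%:R => gK.
have gK0 : 0 < g * K by rewrite mulr_gt0 //; apply: le_lt_trans gK.
rewrite mulNr expRN -[leRHS]invrK lef_pV2 ?posrE ?expR_gt0 ?invr_gt0 //.
apply: le_trans (_ : g * K <= _); last by have := @expR_ge1Dx R (g * K); lra.
by rewrite -ler_pdivrMl // -invfM mulrC ltW // mulrC.
Qed.

Lemma cvg_exprn (u : nat -> R) (a : R) (K : nat) : u @ \oo --> a ->
  u n ^+ K @[n --> \oo] --> a ^+ K.
Proof.
move=> ua; apply: (@continuous_cvg _ _ _ _ _ u (fun x => x ^+ K) a) => //.
exact: exprn_continuous.
Qed.

Lemma cvg_ratio_aux x y (u : nat -> R) : u @ \oo --> 0 ->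
  expR (y / (1 - y * u n) - x) @[n --> \oo] --> expR (y - x).
Proof.
move=> u0; apply: continuous_cvg; first exact: continuous_expR.
apply: cvgB; last exact: cvg_cst.
rewrite -[X in _ --> X](_ : y / (1 - y * 0) = y); last by rewrite mulr0 subr0 divr1.
apply: cvgM; first exact: cvg_cst.
apply: cvgV; first by rewrite mulr0 subr0 oner_eq0.
apply: cvgB; first exact: cvg_cst.
by apply: cvgM => //; exact: cvg_cst.
Qed.

Lemma cvg_ratio_exp x y (d : nat -> nat) :
  (d n)%:R @[n --> \oo] --> (+oo : set_system R) ->
  ((1 - x / (d n)%:R) / (1 - y / (d n)%:R)) ^+ d n @[n --> \oo] --> expR (y - x).
Proof.
move=> d_oo.
have dx z : \forall n \near \oo, z < (d n)%:R :> R by move/cvgryPgt : d_oo.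
have d0 : \forall n \near \oo, (0 < d n)%N.
  by apply: filterS (dx 0) => n; rewrite ltr0n.
have dV : (d n)%:R^-1 @[n --> \oo] --> (0 : R).
  by apply/gtr0_cvgV0 => //; exact: dx.
apply: (@squeeze_cvgr _ _ _ _ (fun n => expR (y - x / (1 - x / (d n)%:R)))
  (fun n => expR (y / (1 - y / (d n)%:R) - x))).
- apply: filterS3 d0 (dx x) (dx y) => n d0 xd yd.
  by rewrite ratio_exp_ge ?ratio_exp_le.
- rewrite -[y - x]opprB expRN.
  under eq_fun do rewrite -opprB expRN.
  by apply: cvgV; [rewrite gt_eqF ?expR_gt0|exact: cvg_ratio_aux].
- exact: cvg_ratio_aux.
Qed.

End RealBounds.

(** * Exponential decay of component sizes *)

Section MeanBounds.
Variables (R : realType) (T : nat -> finType) (adj : forall n, rel (T n))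
  (d : nat -> nat) (eps : nat -> R).
Arguments adj : clear implicits.
Hypotheses (adj_sym : forall n, symmetric (adj n))
  (adj_reg : \forall n \near \oo, forall v, #|neighbors (adj n) v| = d n)
  (d_oo : (d n)%:R @[n --> \oo] --> (+oo : set_system R))
  (eps0 : eps @ \oo --> 0)
  (mixing : \forall n \near \oo, forall S : {set T n},
     (npairs (adj n) S S)%:R <=
       (d n)%:R * #|S|%:R * (#|S|%:R / #|T n|%:R + eps n)).

Local Notation D n := ((d n)%:R : R).
Local Notation N n := (#|T n|%:R : R).
Local Notation mean n p I :=
  (expect (edgep (adj n) p) (fun F => (nverts I F)%:R)).

Lemma near_gt_d x : \forall n \near \oo, x < D n.
Proof. by move/cvgryPgt : d_oo. Qed.

Lemma near_density x : 0 <= x -> \forall n \near \oo, 0 <= x / D n < 1.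
Proof.
move=> x0; apply: filterS (near_gt_d x) => n xd.
by rewrite divr_ge0 // ltr_pdivrMr ?mul1r //; lra.
Qed.

Lemma dV0 : (D n)^-1 @[n --> \oo] --> 0.
Proof. by apply/gtr0_cvgV0 => //; exact: near_gt_d. Qed.

(** Compared with density 1/d, each vertex of a component costs a factor tending to alpha e^(1 -
    alpha) < 1. The free bound [c] on the decay serves both a fixed size threshold and a logarithmic
    one. *)
Lemma subcritical_mean (alpha : R) : 0 < alpha < 1 ->
  exists2 g : R, 0 < g & \forall n \near \oo, forall (I : pred nat) c, 0 <= c ->
    (forall k, I k -> expR (- g * k%:R) <= c) ->
    mean n (alpha / D n) I <= c / alpha * N n.
Proof.
(* Half of the limiting decay rate; the other half absorbs the convergence. *)
move=> /andP[a0 a1]; pose g := (alpha - 1 - ln alpha) / 2.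
have lna : ln alpha < alpha - 1.
  rewrite -ltr_expR lnK ?posrE //.
  have := @expR_gt1Dx R (alpha - 1); rewrite addrCA subrr addr0; apply; lra.
exists g; first by rewrite /g; lra.
have key : \forall n \near \oo,
    alpha * ((1 - alpha / D n)/ (1 - 1 / D n)) ^+ d n < expR (- g).
  apply: (cvgr_lt (alpha * expR (1 - alpha))).
    by apply: cvgM; [exact: cvg_cst|exact: cvg_ratio_exp].
  by rewrite -{1}[alpha]lnK ?posrE // -expRD ltr_expR /g; lra.
apply: filterS3 key (near_gt_d 1) adj_reg => n key d1 reg I c c0 Ic.
have d0 : 0 < D n by lra.
apply: (@le_trans _ _ (c / alpha * mean n (1 / D n) I)); last first.
  rewrite ler_wpM2l ?divr_ge0 // ?(ltW a0) // mean_le // divr_ge0 ?(ltW d0) //=.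
  by rewrite ler_pdivrMr // mul1r; lra.
apply: mean_le_mul => S S0 IS.
have ad : 0 < alpha / D n by rewrite divr_gt0.
have ad1 : alpha / D n <= 1 / D n by rewrite ler_wpM2r ?invr_ge0 // ltW.
have d1' : 1 / D n < 1 by rewrite ltr_pdivrMr // mul1r.
have := component_prob_ge (@adj_sym n) reg S ad ad1 d1'.
set P := prob _ _; set Q := prob _ _ => PQ.
pose w := ((1 - alpha / D n) / (1 - 1 / D n)) ^+ d n.
have w0 : 0 < w by rewrite exprn_gt0 // divr_gt0; lra.
have Q0 : 0 <= Q by apply: prob_ge0; apply: edgep_prob; lra.
have e1 : (1 / D n / (alpha / D n)) ^+ #|S|.-1 *
   ((1 - 1 / D n) / (1 - alpha / D n)) ^+ (#|S| * d n) =
   alpha / (alpha * w) ^+ #|S|.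
  rewrite (_ : 1 / D n / (alpha / D n) = alpha^-1); last by field; lra.
  rewrite -[X in _ * X ^+ _]invf_div mulnC exprM [in X in _ * X]exprVn -/w !exprVn.
  rewrite exprMn -[in RHS](prednK S0) [alpha ^+ _.+1]exprS (prednK S0).
  have [wn an] : w != 0 /\ alpha != 0 by split; rewrite gt_eqF.
  by field; rewrite (expf_neq0 _ wn) (expf_neq0 _ an) an.
rewrite {}e1 in PQ.
have aw : 0 < (alpha * w) ^+ #|S| by rewrite exprn_gt0 // mulr_gt0.
have {}PQ : P <= (alpha * w) ^+ #|S| / alpha * Q.
  rewrite mulrC -ler_pdivrMr ?divr_gt0 // invf_div; exact: PQ.
apply: (le_trans PQ); rewrite ler_wpM2r // ler_wpM2r ?invr_ge0 ?(ltW a0) //.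
apply: le_trans (Ic _ IS); rewrite expRM_natr.
by rewrite lerXn2r ?nnegrE ?expR_ge0 ?(ltW key) // mulr_ge0 // ltW.
Qed.

(* Components of size at most (1 - t) / 4 of the graph, where
   t = ln alpha / (alpha - 1) < 1, have so many boundary edges that their
   probability decays exponentially. *)
Lemma supercritical_gap (alpha : R) : 1 < alpha ->
  exists2 b : R, 0 < b & exists2 g : R, 0 < g &
  \forall n \near \oo, forall (I : pred nat) c, 0 <= c ->
    (forall k, I k -> k%:R <= b * N n /\ expR (- g * k%:R) <= c) ->
    mean n (alpha / D n) I <= c / alpha * N n.
Proof.
move=> a1; have a0 : 0 < alpha by lra.
have lna : ln alpha < alpha - 1.
  rewrite -ltr_expR lnK ?posrE //.
  have := @expR_gt1Dx R (alpha - 1); rewrite addrCA subrr addr0; apply; lra.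
have lna0 : 0 < ln alpha by rewrite ln_gt0.
(* Decay requires a boundary of more than a fraction t of the kd edge ends; [1 - b *+ 2] is the
   midpoint of t and 1. *)
pose b := (1 - ln alpha / (alpha - 1)) / 4.
have t1 : 0 < ln alpha / (alpha - 1) < 1.
  by rewrite divr_gt0 ?ltr_pdivrMr ?mul1r //; lra.
pose g := (alpha - 1 - ln alpha) / 4.
have b0 : 0 < b by rewrite /b; lra.
have g0 : 0 < g by rewrite /g; lra.
have bE : ln alpha + (1 - b *+ 2) * (1 - alpha) = - g *+ 2.
  by rewrite /b /g; field; lra.
exists b => //; exists g => //.
(* [h n / D n] bounds the logarithm of the cost of a boundary edge. It must be negative for a lower
   bound on the boundary to be of use. *)
pose h n := (1 - 1 * (D n)^-1)^-1 - alpha.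
have hcvg : h n @[n --> \oo] --> (1 - alpha).
  apply: cvgB; last exact: cvg_cst.
  rewrite -[X in _ --> X]invr1; apply: cvgV; first by rewrite oner_eq0.
  rewrite -[X in _ --> X](_ : 1 - 1 * 0 = 1 :> R); last by rewrite mulr0 subr0.
  by apply: cvgB; [exact: cvg_cst|apply: cvgM; [exact: cvg_cst|exact: dV0]].
have nh1 : \forall n \near \oo, h n < 0 by apply: (cvgr_lt _ hcvg); lra.
have nh2 : \forall n \near \oo, ln alpha + (1 - b *+ 2) * h n < - g.
  apply: (cvgr_lt (ln alpha + (1 - b *+ 2) * (1 - alpha))); last by rewrite bE mulr2n; lra.
  by apply: cvgD; [exact: cvg_cst|apply: cvgM => //; exact: cvg_cst].
have nh3 : \forall n \near \oo, eps n < b by apply: (cvgr_lt _ eps0).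
near=> n => I c c0 Ic.
have d1 : alpha < D n by near: n; exact: near_gt_d.
have d0 : 0 < D n by lra.
have reg : forall v, #|neighbors (adj n) v| = d n by near: n.
have mix : forall S : {set T n}, (npairs (adj n) S S)%:R <=
       (d n)%:R * #|S|%:R * (#|S|%:R / #|T n|%:R + eps n) by near: n.
have h1 : h n < 0 by near: n.
have h2 : ln alpha + (1 - b *+ 2) * h n < - g by near: n.
have h3 : eps n < b by near: n.
apply: (@le_trans _ _ (c / alpha * mean n (1 / D n) I)); last first.
  rewrite ler_wpM2l ?divr_ge0 // ?(ltW a0) // mean_le // divr_ge0 ?(ltW d0) //=.
  by rewrite ler_pdivrMr // mul1r; lra.
apply: mean_le_mul => S S0 IS.
have [kb kc] := Ic _ IS.
have ad : 0 < 1 / D n by rewrite divr_gt0.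
have ad1 : 1 / D n <= alpha / D n by rewrite ler_wpM2r ?invr_ge0 // ltW.
have d1' : alpha / D n < 1 by rewrite ltr_pdivrMr // mul1r.
have := component_prob_le (adj n) S ad ad1 d1'.
set P := prob _ _; set Q := prob _ _; set m := npairs _ _ _ => PQ.
have Q0 : 0 <= Q by apply: prob_ge0; apply: edgep_prob; lra.
apply: (le_trans PQ); rewrite ler_wpM2r //.
have -> : alpha / D n / (1 / D n) = alpha by field; lra.
rewrite -ler_pdivlMl ?divr_gt0 // ?exprn_gt0 //.
have k0 : 0 < #|S|%:R :> R by rewrite ltr0n.
(* One [b] pays for the density of [S], the other for the mixing error. *)
have mk : D n * #|S|%:R * (1 - b *+ 2) <= m%:R.
  have N0 : 0 < N n.
    rewrite ltr0n; apply: leq_trans S0 _; exact: max_card.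
  have eqm : m%:R = #|S|%:R * D n - (npairs (adj n) S S)%:R.
    by rewrite -natrM -(npairsT reg) -(npairsC (adj n) S S) natrD addrC addKr.
  rewrite eqm; have := mix S.
  have : #|S|%:R / N n <= b by rewrite ler_pdivrMr.
  have dk : 0 < D n * #|S|%:R by rewrite mulr_gt0.
  move=> kN mS.
  have : D n * #|S|%:R * (#|S|%:R / N n + eps n) <= D n * #|S|%:R * (b + b).
    by rewrite ler_pM2l // lerD // ltW.
  by rewrite mulr2n; nra.
apply: (@le_trans _ _ (expR (#|S|%:R * ((1 - b *+ 2) * h n)))).
  apply: (@le_trans _ _ (expR (h n / D n * m%:R))).
    rewrite expRM_natr lerXn2r ?nnegrE ?expR_ge0 ?divr_ge0; try lra.
    have dn0 : (0 < d n)%N by rewrite -(ltr0n R).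
    by apply: le_trans (ratio_le_expR dn0 _ _) _; rewrite /h ?mul1r //; lra.
  rewrite ler_expR.
  have := ler_wnM2l (ltW h1) mk; rewrite -(ler_pM2r (_ : 0 < (D n)^-1)) ?invr_gt0 //.
  by congr (_ <= _); field; lra.
rewrite -ler_pdivrMl ?invr_gt0 ?exprn_gt0 // invrK.
apply: (@le_trans _ _ (expR (- g * #|S|%:R) / alpha)); last first.
  by rewrite ler_wpM2r ?invr_ge0 // ltW.
rewrite ler_pdivlMr // mulrAC -exprSr prednK //.
rewrite -{1}[alpha]lnK ?posrE // -expRM_natl -expRD ler_expR -mulrDr mulrC.
by rewrite ler_pM2r // ltW.
Unshelve. all: by end_near.
Qed.

End MeanBounds.

(** The alpha whose dual is q alpha: x e^(-x) agrees at alpha and q alpha exactly when q = e^(-(1 -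
    q) alpha). Parametrising by the ratio q makes alpha explicit. *)
Definition dual_density (R : realType) (q : R) : R := - ln q / (1 - q).

Lemma dual_density_gt1 (R : realType) (q : R) : 0 < q < 1 -> 1 < dual_density q.
Proof.
move=> /andP[q0 q1]; rewrite /dual_density ltr_pdivlMr; last lra.
suff : ln q < q - 1 by lra.
rewrite -ltr_expR lnK ?posrE //.
by have := @expR_gt1Dx R (q - 1); rewrite addrCA subrr addr0; apply; lra.
Qed.

Lemma dual_density_mul (R : realType) (q : R) : 0 < q < 1 ->
  0 < q * dual_density q < 1.
Proof.
move=> /andP[q0 q1].
rewrite mulr_gt0 //=; last by have := @dual_density_gt1 R q; rewrite q0 q1; lra.
rewrite /dual_density mulrA ltr_pdivrMr ?mul1r; last lra.
have qV : q^-1 != 1 by rewrite invr_eq1; lra.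
have : - ln q < q^-1 - 1.
  rewrite -lnV ?posrE // -ltr_expR lnK ?posrE ?invr_gt0 //.
  by have := @expR_gt1Dx R (q^-1 - 1); rewrite addrCA subrr addr0; apply; rewrite subr_eq0.
rewrite -(ltr_pM2l q0) => h; apply: (lt_le_trans h).
by rewrite mulrBr divff ?gt_eqF // mulr1.
Qed.

(** * Vertices in bounded components *)

Section SmallComponents.
Variables (R : realType) (T : nat -> finType) (adj : forall n, rel (T n))
  (d : nat -> nat).
Arguments adj : clear implicits.
Hypotheses (adj_sym : forall n, symmetric (adj n))
  (adj_reg : \forall n \near \oo, forall v, #|neighbors (adj n) v| = d n)
  (d_oo : (d n)%:R @[n --> \oo] --> (+oo : set_system R))
  (N_oo : #|T n|%:R @[n --> \oo] --> (+oo : set_system R)).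

Local Notation D n := ((d n)%:R : R).
Local Notation N n := (#|T n|%:R : R).
Local Notation mean n p I :=
  (expect (edgep (adj n) p) (fun F => (nverts I F)%:R)).

Implicit Types (p : nat -> R) (B : forall n : nat, pred {set {set T n}}).

Lemma near_gt_N x : \forall n \near \oo, x < N n.
Proof. by move/cvgryPgt : N_oo. Qed.

Lemma NV0 : (N n)^-1 @[n --> \oo] --> 0.
Proof. by apply/gtr0_cvgV0 => //; exact: near_gt_N. Qed.

Definition rare (p : nat -> R) (B : forall n, pred {set {set T n}}) :=
  forall e, 0 < e -> \forall n \near \oo,
    prob (edgep (adj n) (p n)) (B n) <= e.

Lemma cvg0_rare p B (u : nat -> R) : u @ \oo --> 0 ->
  (\forall n \near \oo, prob (edgep (adj n) (p n)) (B n) <= u n) -> rare p B.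
Proof.
move=> u0 Bu e e0; have ue : \forall n \near \oo, u n <= e.
  by apply: (cvgr_le _ u0).
by apply: filterS2 Bu ue => n; exact: le_trans.
Qed.

Lemma rareU p B B1 B2 :
  (\forall n \near \oo, 0 <= p n <= 1) ->
  (\forall n \near \oo, forall F, B n F -> B1 n F || B2 n F) ->
  rare p B1 -> rare p B2 -> rare p B.
Proof.
move=> p01 BB r1 r2 e e0; have e2 : 0 < e / 2 by lra.
near=> n; have le1 : prob (edgep (adj n) (p n)) (B1 n) <= e / 2.
  by near: n; exact: r1.
have le2 : prob (edgep (adj n) (p n)) (B2 n) <= e / 2 by near: n; exact: r2.
apply: (@le_trans _ _ (prob (edgep (adj n) (p n)) (B1 n) + prob (edgep (adj n) (p n)) (B2 n))).
  by apply: prob_le_union; [apply: edgep_prob; near: n|near: n].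
lra.
Unshelve. all: by end_near.
Qed.

Lemma rare_sub p B B1 :
  (\forall n \near \oo, 0 <= p n <= 1) ->
  (\forall n \near \oo, forall F, B n F -> B1 n F) ->
  rare p B1 -> rare p B.
Proof.
move=> p01 BB r1; apply: (@rareU _ _ B1 B1) => //.
by apply: filterS BB => n BB F /BB ->.
Qed.

Lemma rare_cvg1 p (A : forall n, pred {set {set T n}}) :
  (\forall n \near \oo, 0 <= p n <= 1) ->
  rare p (fun n => predC (A n)) ->
  prob (edgep (adj n) (p n)) (A n) @[n --> \oo] --> (1 : R).
Proof.
move=> p01 rA; apply/cvgrPdist_le => e e0.
apply: filterS2 p01 (rA e e0) => n p01; rewrite probC ger0_norm // subr_ge0.
by apply: prob_le1; exact: edgep_prob.
Qed.

(** Chebyshev's inequality: with [K] fixed, the variance is of smaller order than N^2 because both d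
    and N tend to infinity. *)
Lemma concentration (alpha : R) K e : 0 <= alpha -> 0 < e ->
  rare (fun n => alpha / D n) (fun n F =>
    e * N n <= `|(nverts (fun k => (k <= K)%N) F)%:R -
                 mean n (alpha / D n) (fun k => (k <= K)%N)|).
Proof.
move=> a0 e0; pose I k := (k <= K)%N.
apply: (@cvg0_rare _ _ (fun n =>
   (((1 - alpha * (D n)^-1) ^+ (K * K))^-1 - 1 + K%:R * (N n)^-1) / e ^+ 2)).
  rewrite -[X in _ --> X](mul0r (e ^+ 2)^-1); apply: cvgM; last exact: cvg_cst.
  rewrite -[X in _ --> X](addr0 0); apply: cvgD; last first.
    by rewrite -[X in _ --> X](mulr0 K%:R); apply: cvgM; [exact: cvg_cst|exact: NV0].
  rewrite -[X in _ --> X](subrr 1); apply: cvgB; last exact: cvg_cst.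
  rewrite -[X in _ --> X]invr1; apply: cvgV; first by rewrite oner_eq0.
  rewrite -[X in _ --> X](expr1n _ (K * K)).
  apply: cvg_exprn.
  rewrite -[X in _ --> X](subr0 1); apply: cvgB; first exact: cvg_cst.
  rewrite -[X in _ --> X](mulr0 alpha); apply: cvgM; first exact: cvg_cst.
  exact: dV0.
apply: filterS2 (near_density d_oo a0) (near_gt_N 0) => n p01 N0.
have p01' : 0 <= alpha / D n <= 1 by lra.
set mu := mean n _ _; set p := alpha / D n in p01 p01' mu *.
have mu0 : 0 <= mu by apply: expect_ge0 => //; exact: edgep_prob.
have muN : mu <= N n by exact: mean_le.
set P := prob _ _; set z := ((1 - p) ^+ (K * K))^-1.
have z1 : 1 <= z.
  by rewrite invf_ge1 ?exprn_gt0 ?exprn_ile1; lra.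
have : (e * N n) ^+ 2 * P <= N n ^+ 2 * (z - 1) + K%:R * N n.
  apply: (finite_chebyshev (p := edgep (adj n) p) (f := fun F => (nverts I F)%:R) (m := mu) (c := e * N n)) => //.
  - exact: edgep_prob.
  - exact: mulr_gt0.
  apply: le_trans (@second_moment _ _ (adj n) p I K p01 _) _ => //.
  rewrite -/z -/mu.
  have : mu ^+ 2 * (z - 1) <= N n ^+ 2 * (z - 1).
    by rewrite ler_wpM2r ?subr_ge0 // lerXn2r ?nnegrE // ltW.
  have : K%:R * mu <= K%:R * N n by rewrite ler_wpM2l.
  by rewrite -/mu; lra.
rewrite exprMn mulrAC -ler_pdivlMr ?exprn_gt0 // => h.
rewrite ler_pdivlMr ?exprn_gt0 // mulrC; apply: (le_trans h).
by rewrite le_eqVlt; apply/orP; left; apply/eqP; field; lra.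
Qed.

Section Dual.
Variables q alpha : R.
Hypotheses (q01 : 0 < q < 1) (alphaE : alpha = dual_density q).
(** [u n] is the comparison factor per vertex when the boundary is taken to be kd. That alpha and q
    alpha are dual means precisely that it tends to 1. *)
Let b n := (1 - alpha / D n) / (1 - q * alpha / D n).
Let u n := q^-1 * b n ^+ d n.

Lemma dual_facts : [/\ 0 < q, 1 < alpha, 0 < alpha & 0 < q * alpha < 1].
Proof.
have a1 : 1 < alpha by rewrite alphaE dual_density_gt1.
case/andP: (q01) => q0 _; split=> //; first lra.
by rewrite alphaE dual_density_mul.
Qed.

Let u1 : `|u n - 1| @[n --> \oo] --> 0.
Proof.
have [q0 alpha1 alpha0 qa1] := dual_facts.
rewrite -[X in _ --> X](normr0 R); apply: cvg_norm.
rewrite -[X in _ --> X](subrr 1); apply: cvgB; last exact: cvg_cst.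
have <- : q^-1 * expR (q * alpha - alpha) = 1.
  rewrite (_ : q * alpha - alpha = ln q).
    by rewrite lnK ?posrE // mulVf // gt_eqF.
  have q1 : 1 - q != 0 by rewrite subr_eq0 eq_sym lt_eqF //; case/andP: q01.
  by rewrite alphaE /dual_density; field.
by apply: cvgM; [exact: cvg_cst|exact: cvg_ratio_exp].
Qed.

(** The leading [q] comes from the exponent k - 1, as a tree on k vertices has k - 1 edges; it is
    all that survives in the limit. *)
Let uE n k : (0 < k)%N ->
  q * u n ^+ k = q^-1 ^+ k.-1 * b n ^+ (k * d n).
Proof.
have [q0 _ _ _] := dual_facts => k0; rewrite /u exprMn mulrA; congr (_ * _).
  by rewrite -{1}(prednK k0) exprS mulrA divff ?gt_eqF // mul1r.
by rewrite -exprM mulnC.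
Qed.

(** The boundary of a set of at most [K] vertices falls short of kd by at most [K * K], and
    [b n ^+ (K * K)] tends to 1. *)
Lemma mean_small_le K e : 0 < e -> \forall n \near \oo, forall I : pred nat,
  (forall k, I k -> (k <= K)%N) -> mean n (alpha / D n) I <= (q + e) * N n.
Proof.
have [q0 alpha1 alpha0 qa1] := dual_facts.
move=> e0.
have key : \forall n \near \oo, q * (1 + `|u n - 1|) ^+ K / b n ^+ (K * K) <= q + e.
  apply: (cvgr_le q); last lra.
  rewrite -[X in _ --> X]divr1; apply: cvgM.
    rewrite -[X in _ --> X]mulr1; apply: cvgM; first exact: cvg_cst.
    rewrite -[X in _ --> X](expr1n _ K).
    apply: cvg_exprn.
    rewrite -[X in _ --> X](addr0 1); apply: cvgD; first exact: cvg_cst.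
    exact: u1.
  apply: cvgV; first by rewrite oner_eq0.
  rewrite -[X in _ --> X](expr1n _ (K * K)).
  apply: cvg_exprn.
  have lin (x : R) : 1 - x / D n @[n --> \oo] --> (1 : R).
    rewrite -[X in _ --> X](subr0 1); apply: cvgB; first exact: cvg_cst.
    rewrite -[X in _ --> X](mulr0 x); apply: cvgM; first exact: cvg_cst.
    exact: dV0.
  rewrite -[X in _ --> X]divr1; apply: cvgM; first exact: lin.
  by apply: cvgV; [rewrite oner_eq0|exact: lin].
apply: filterS3 key (near_gt_d d_oo alpha) adj_reg => n key da reg I IK.
have d0 : 0 < D n := lt_trans alpha0 da.
have p1 : alpha / D n < 1 by rewrite ltr_pdivrMr // mul1r.
have p0 : 0 < q * alpha / D n by rewrite divr_gt0 //; lra.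
have qp : q * alpha / D n <= alpha / D n by rewrite ler_wpM2r ?invr_ge0 //; lra.
apply: (@le_trans _ _ ((q + e) * mean n (q * alpha / D n) I)); last first.
  by rewrite ler_wpM2l ?mean_le //; lra.
apply: mean_le_mul => S S0 /IK SK.
have := component_prob_le (adj n) S p0 qp p1; rewrite -/(b n).
set P := prob _ _; set Q := prob _ _; set m := npairs _ _ _ => PQ.
have Q0 : 0 <= Q by apply: prob_ge0; apply: edgep_prob; lra.
apply: (le_trans PQ); rewrite ler_wpM2r //; apply: le_trans key.
have b0 : 0 < b n by rewrite divr_gt0; lra.
have b1 : b n <= 1 by rewrite ler_pdivrMr; lra.
have -> : alpha / D n / (q * alpha / D n) = q^-1 by field; lra.
rewrite ler_pdivlMr ?exprn_gt0 //.
have mK : (#|S| * d n <= m + K * K)%N.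
  rewrite -(npairsT reg) -(npairsC (adj n) S S) addnC leq_add2l.
  by apply: leq_trans (npairs_le _ _ _) _; rewrite leq_mul.
rewrite -mulrA -exprD.
apply: (@le_trans _ _ (q * u n ^+ #|S|)).
  rewrite uE // ler_wpM2l ?exprn_ge0 ?invr_ge0 ?(ltW q0) //.
  by apply: ler_wiXn2l => //; exact: ltW.
rewrite ler_wpM2l ?(ltW q0) //.
have u0 : 0 <= u n by rewrite mulr_ge0 ?exprn_ge0 ?invr_ge0 ?(ltW q0) // ltW.
apply: (@le_trans _ _ ((1 + `|u n - 1|) ^+ #|S|)).
  by rewrite lerXn2r ?nnegrE ?addr_ge0 //; have := ler_norm (u n - 1); lra.
by apply: ler_weXn2l => //; rewrite lerDl.
Qed.

Lemma mean_small_ge_dual K e : 0 < e -> \forall n \near \oo,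
  (q - e) * mean n (q * alpha / D n) (fun k => (k <= K)%N) <=
  mean n (alpha / D n) (fun k => (k <= K)%N).
Proof.
have [q0 alpha1 alpha0 qa1] := dual_facts.
move=> e0.
have key : \forall n \near \oo, q - e <= q * (1 - `|u n - 1|) ^+ K.
  apply: (cvgr_ge q); last lra.
  rewrite -[X in _ --> X]mulr1; apply: cvgM; first exact: cvg_cst.
  rewrite -[X in _ --> X](expr1n _ K).
  apply: cvg_exprn.
  rewrite -[X in _ --> X](subr0 1); apply: cvgB; first exact: cvg_cst.
  exact: u1.
have ule : \forall n \near \oo, `|u n - 1| <= 1 by apply: (cvgr_le _ u1).
near=> n.
have da : alpha < D n by near: n; exact: near_gt_d.
have ul : `|u n - 1| <= 1 by near: n.
have ky : q - e <= q * (1 - `|u n - 1|) ^+ K by near: n.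
have reg : forall v, #|neighbors (adj n) v| = d n by near: n.
have d0 : 0 < D n := lt_trans alpha0 da.
have p1 : alpha / D n < 1 by rewrite ltr_pdivrMr // mul1r.
have p0 : 0 < q * alpha / D n by rewrite divr_gt0 //; lra.
have qp : q * alpha / D n <= alpha / D n by rewrite ler_wpM2r ?invr_ge0 //; lra.
apply: mean_ge_mul => S S0 SK.
have := component_prob_ge (@adj_sym n) reg S p0 qp p1; rewrite -/(b n).
set P := prob _ _; set Q := prob _ _ => PQ.
have Q0 : 0 <= P by apply: prob_ge0; apply: edgep_prob; lra.
apply: le_trans PQ; rewrite mulrC ler_wpM2l //; apply: (le_trans ky).
have -> : alpha / D n / (q * alpha / D n) = q^-1 by field; lra.
apply: (@le_trans _ _ (q * u n ^+ #|S|)); last first.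
  by rewrite uE.
rewrite ler_wpM2l ?(ltW q0) //.
have un := ler_norm (- (u n - 1)); rewrite normrN in un.
apply: (@le_trans _ _ ((1 - `|u n - 1|) ^+ #|S|)).
  by apply: ler_wiXn2l; [lra|rewrite gerBl|].
by rewrite lerXn2r ?nnegrE //; lra.
Unshelve. all: by end_near.
Qed.

Lemma mean_small_ge e : 0 < e -> exists K, \forall n \near \oo,
  (q - e) * N n <= mean n (alpha / D n) (fun k => (k <= K)%N).
Proof.
have [q0 alpha1 alpha0 qa1] := dual_facts.
move=> e0; have [g g0 sub] := @subcritical_mean R T adj d adj_sym adj_reg d_oo _ qa1.
pose f K := expR (- g * K%:R) / (q * alpha).
(* [f K] bounds the fraction of vertices in components larger than [K] at the dual density. *)
have [K fK] : exists K, f K * q <= e / 2.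
  have x0 : 0 < e / 2 * alpha by rewrite mulr_gt0 //; lra.
  have [K fK] := exists_expR_le g0 x0; exists K.
  rewrite (_ : f K * q = expR (- g * K%:R) / alpha); first by rewrite ler_pdivrMr.
  by rewrite /f; field; lra.
exists K.
have e2 : 0 < e / 2 by lra.
have sm := mean_small_ge_dual K e2.
near=> n.
have smn : (q - e / 2) * mean n (q * alpha / D n) (fun k => (k <= K)%N) <=
  mean n (alpha / D n) (fun k => (k <= K)%N) by near: n.
have da : alpha < D n by near: n; exact: near_gt_d.
have d0 : 0 < D n := lt_trans alpha0 da.
have p01 : 0 <= q * alpha / D n <= 1.
  by rewrite divr_ge0 ?ler_pdivrMr ?mul1r //; lra.
have big : mean n (q * alpha / D n) (fun k => (K < k)%N) <= f K * N n.
  have : forall (I : pred nat) c, 0 <= c ->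
    (forall k, I k -> expR (- g * k%:R) <= c) ->
    mean n (q * alpha / D n) I <= c / (q * alpha) * N n by near: n.
  apply; first exact: expR_ge0.
  by move=> k Kk; rewrite ler_expR !mulNr lerN2 ler_pM2l // ler_nat ltnW.
have N0 : 0 < N n by near: n; exact: near_gt_N.
have tot : N n <= mean n (q * alpha / D n) (fun k => (k <= K)%N) +
    mean n (q * alpha / D n) (fun k => (K < k)%N).
  rewrite -expectD -[leLHS](meanT (adj n) (q * alpha / D n)).
  apply: ler_expect => [|F]; first exact: edgep_prob.
  by rewrite -natrD ler_nat; apply: nvertsU => k _; case: leqP.
set M := mean n (q * alpha / D n) _ in smn tot.
have M0 : 0 <= M by apply: expect_ge0 => //; exact: edgep_prob.
have MN : M <= N n by exact: mean_le.
apply: le_trans smn.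
have h2 : (q - f K * q) * N n <= q * M.
  have : (1 - f K) * N n <= M by lra.
  by rewrite -(ler_pM2l q0); nra.
have h3 : (q - e / 2) * N n <= q * M.
  by apply: le_trans h2; rewrite ler_wpM2r ?(ltW N0) //; lra.
have : e / 2 * M <= e / 2 * N n by rewrite ler_pM2l.
by nra.
Unshelve. all: by end_near.
Qed.

Let p01 : \forall n \near \oo, 0 <= alpha / D n <= 1.
Proof.
have [q0 alpha1 alpha0 qa1] := dual_facts.
have a0 : 0 <= alpha := ltW alpha0.
by apply: filterS (near_density d_oo a0) => n; lra.
Qed.

Lemma rare_few_small e : 0 < e -> exists K,
  rare (fun n => alpha / D n) (fun n F =>
    (nverts (fun k => (k <= K)%N) F)%:R < (q - e) * N n).
Proof.
have [q0 alpha1 alpha0 qa1] := dual_facts.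
move=> e0; have e2 : 0 < e / 2 by lra.
have [K mK] := mean_small_ge e2; exists K.
have a0 : 0 <= alpha := ltW alpha0.
apply: rare_sub p01 _ (concentration K a0 e2).
apply: filterS mK => n mK F YF; rewrite distrC.
apply: le_trans (ler_norm _); lra.
Qed.

Lemma rare_many_small K e : 0 < e ->
  rare (fun n => alpha / D n) (fun n F =>
    (q + e) * N n < (nverts (fun k => (k <= K)%N) F)%:R).
Proof.
have [q0 alpha1 alpha0 qa1] := dual_facts.
move=> e0; have e2 : 0 < e / 2 by lra.
have a0 : 0 <= alpha := ltW alpha0.
apply: rare_sub p01 _ (concentration K a0 e2).
apply: filterS (mean_small_le K e2) => n /(_ (fun k => (k <= K)%N) (fun _ => id)) mK F YF.
apply: le_trans (ler_norm _); lra.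
Qed.

End Dual.
End SmallComponents.

(** This lets the density be lowered by raising [q]. The value at [q] is the slope of the chord of
    ln from [q] to 1; in place of concavity, two tangent bounds are combined with weights that
    cancel the rational parts. *)
Lemma dual_density_decr (R : realType) (q q1 : R) : 0 < q -> q < q1 -> q1 < 1 ->
  dual_density q1 < dual_density q.
Proof.
move=> q0 qq1 q11; rewrite /dual_density.
have q10 : 0 < q1 by lra.
have ln_lt (x : R) : 0 < x -> x != 1 -> ln x < x - 1.
  move=> x0 x1; rewrite -ltr_expR lnK ?posrE //.
  by have := @expR_gt1Dx R (x - 1); rewrite addrCA subrr addr0; apply; rewrite subr_eq0.
have h1 : ln q - ln q1 < q / q1 - 1.
  rewrite -ln_div ?posrE //; apply: ln_lt; first exact: divr_gt0.
  by rewrite lt_eqF // ltr_pdivrMr // mul1r.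
have h2 : - ln q1 < q1^-1 - 1.
  rewrite -lnV ?posrE //; apply: ln_lt; first by rewrite invr_gt0.
  by rewrite gt_eqF // invf_gt1.
rewrite ltr_pdivrMr; last lra.
rewrite mulrAC ltr_pdivlMr; last lra.
have h1' : (1 - q1) * (ln q - ln q1) < (1 - q1) * (q / q1 - 1) by rewrite ltr_pM2l //; lra.
have h2' : (q1 - q) * - ln q1 < (q1 - q) * (q1^-1 - 1) by rewrite ltr_pM2l //; lra.
have : (1 - q1) * (q / q1 - 1) + (q1 - q) * (q1^-1 - 1) = 0 by field; lra.
lra.
Qed.

Lemma two_components_le (T : finType) (I : pred nat) (F : {set {set T}})
    (L K : {set T}) : L \in components F -> K \in components F -> K != L ->
  ~~ I #|L| -> ~~ I #|K| -> (nverts I F + #|L| + #|K| <= #|T|)%N.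
Proof.
move=> LF KF KL IL IK; rewrite -(nvertsT F) /nverts.
rewrite [leqRHS](eq_bigl (mem (components F))); last by move=> S; rewrite andbT.
rewrite [leqRHS](bigID (fun S : {set T} => I #|S|)) /= -addnA leq_add2l.
rewrite (bigD1 L) ?LF //= leq_add2l (bigD1 K) ?KF ?KL ?IK //=.
by rewrite leq_addr.
Qed.

Lemma one_component_le (T : finType) (I : pred nat) (F : {set {set T}})
    (L : {set T}) : L \in components F -> ~~ I #|L| ->
  (nverts I F + #|L| <= #|T|)%N.
Proof.
move=> LF IL; rewrite -(nvertsT F) /nverts.
rewrite [leqRHS](eq_bigl (mem (components F))); last by move=> S; rewrite andbT.
rewrite [leqRHS](bigID (fun S : {set T} => I #|S|)) /= leq_add2l.
by rewrite (bigD1 L) ?LF //= leq_addr.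
Qed.

Lemma one_component_ge (T : finType) (I : pred nat) (F : {set {set T}})
    (L : {set T}) :
  (forall K, K \in components F -> ~~ I #|K| -> K = L) ->
  (#|T| <= nverts I F + #|L|)%N.
Proof.
move=> uniqL; rewrite -(nvertsT F) /nverts.
rewrite [leqLHS](eq_bigl (mem (components F))); last by move=> S; rewrite andbT.
rewrite [leqLHS](bigID (fun S : {set T} => I #|S|)) /= leq_add2l.
rewrite -[leqRHS](@big_pred1_eq nat 0%N addn _ L (fun S : {set T} => #|S|)) [leqLHS]big_mkcond [leqRHS]big_mkcond.
apply: leq_sum => S _ /=.
by case: ifP => // /andP[SF IS]; rewrite (uniqL _ SF IS) eqxx.
Qed.

(** * The giant component and its uniqueness *)

Section Giant.
Variables (R : realType) (T : nat -> finType) (adj : forall n, rel (T n))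
  (d : nat -> nat) (eps : nat -> R).
Arguments adj : clear implicits.
Hypotheses (adj_sym : forall n, symmetric (adj n))
  (adj_reg : \forall n \near \oo, forall v, #|neighbors (adj n) v| = d n)
  (d_oo : (d n)%:R @[n --> \oo] --> (+oo : set_system R))
  (N_oo : #|T n|%:R @[n --> \oo] --> (+oo : set_system R))
  (eps0 : eps @ \oo --> 0)
  (mixing : \forall n \near \oo, forall S : {set T n},
     (npairs (adj n) S S)%:R <=
       (d n)%:R * #|S|%:R * (#|S|%:R / #|T n|%:R + eps n))
  (mixing2 : \forall n \near \oo, forall S S' : {set T n},
     (d n)%:R * (#|S|%:R * #|S'|%:R / #|T n|%:R - eps n * #|T n|%:R) <=
     (npairs (adj n) S S')%:R).

Local Notation D n := ((d n)%:R : R).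
Local Notation N n := (#|T n|%:R : R).
Local Notation mean n p I :=
  (expect (edgep (adj n) p) (fun F => (nverts I F)%:R)).

Lemma near_prob alpha : 0 <= alpha -> \forall n \near \oo, 0 <= alpha / D n <= 1.
Proof. by move=> a0; apply: filterS (near_density d_oo a0) => n; lra. Qed.

(** Above [2 / g * ln (N n)] the decay factor is at most N^(-2), which leaves 1 / (alpha N) after
    the factor N of the mean bound. *)
Lemma rare_mid_size (alpha g : R) (J : forall n : nat, pred nat) :
  0 < alpha -> 0 < g ->
  (\forall n \near \oo, forall (I : pred nat) c, 0 <= c ->
    (forall k, I k -> J n k /\ expR (- g * k%:R) <= c) ->
    mean n (alpha / D n) I <= c / alpha * N n) ->
  rare adj (fun n => alpha / D n) (fun n F =>
    [exists S in components F, J n #|S| && (2 / g * ln (N n) < #|S|%:R)]).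
Proof.
move=> a0 g0 meanJ.
apply: (cvg0_rare (u := fun n => (N n)^-1 * alpha^-1)).
  rewrite -[X in _ --> X](mul0r alpha^-1).
  by apply: cvgM; [exact: NV0|exact: cvg_cst].
near=> n.
have N0 : 0 < N n by near: n; exact: near_gt_N.
have p01 : 0 <= alpha / D n <= 1 by near: n; apply: near_prob; exact: ltW.
have meann : forall (I : pred nat) c, 0 <= c ->
    (forall k, I k -> J n k /\ expR (- g * k%:R) <= c) ->
    mean n (alpha / D n) I <= c / alpha * N n by near: n.
apply: le_trans (prob_exists_component_le (adj n) (fun k => J n k && (2 / g * ln (N n) < k%:R)) p01) _.
have -> : (N n)^-1 / alpha = (N n)^-1 ^+ 2 / alpha * N n by field; lra.
apply: meann; first by rewrite exprn_ge0 // invr_ge0 ltW.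
move=> k /andP[Jk kN]; split=> //.
rewrite -[in leRHS](@lnK _ (N n)) ?posrE // -expRN -expRM_natl ler_expR.
rewrite mulrAC ltr_pdivrMr // in kN; rewrite mulNr mulrN lerN2 mulrC [g * _]mulrC.
lra.
Unshelve. all: by end_near.
Qed.

(** Sizes up to a constant [K] hold about q N vertices by duality; sizes between [K] and b N hold
    few by exponential decay and Markov's inequality. *)
Lemma supercritical_small_gap (q alpha : R) : 0 < q < 1 -> alpha = dual_density q ->
  exists2 b : R, 0 < b & exists C : R,
    (forall e, 0 < e -> rare adj (fun n => alpha / D n) (fun n F =>
       (q + e) * N n < (nverts (fun k => k%:R <= b * N n) F)%:R)) /\
    rare adj (fun n => alpha / D n) (fun n F =>
      [exists S in components F,
        (#|S|%:R <= b * N n) && (C * ln (N n) < #|S|%:R)]).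
Proof.
move=> q01 alphaE.
have a1 : 1 < alpha by rewrite alphaE dual_density_gt1.
have a0 : 0 < alpha by lra.
have [b b0 [g g0 gap]] := supercritical_gap adj_reg d_oo eps0 mixing a1.
exists b => //; exists (2 / g); split; last first.
  exact: (rare_mid_size (J := fun n k => k%:R <= b * N n) a0 g0 gap).
move=> e e0 x x0.
have e2 : 0 < e / 2 by lra.
have x2 : 0 < x / 2 by lra.
(* [K] is chosen so that Markov's inequality at level [e / 2 * N n] has failure probability at most
   [x / 2]. *)
have y0 : 0 < x / 2 * (e / 2) * alpha by rewrite !mulr_gt0.
have [K Kx] := exists_expR_le g0 y0.
have many := rare_many_small adj_reg d_oo N_oo q01 alphaE K e2 x2.
have p01 := near_prob (ltW a0).
near=> n.
have N0 : 0 < N n by near: n; exact: near_gt_N.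
have pn : 0 <= alpha / D n <= 1 by near: n.
have manyn : prob (edgep (adj n) (alpha / D n))
   (fun F => (q + e / 2) * N n < (nverts (fun k => (k <= K)%N) F)%:R) <= x / 2 by near: n.
have gapn : forall (I : pred nat) c, 0 <= c ->
    (forall k, I k -> k%:R <= b * N n /\ expR (- g * k%:R) <= c) ->
    mean n (alpha / D n) I <= c / alpha * N n by near: n.
pose J k := (K < k)%N && (k%:R <= b * N n).
have meanJ : mean n (alpha / D n) J <= x / 2 * (e / 2) * N n.
  apply: (@le_trans _ _ (expR (- g * K%:R) / alpha * N n)).
    apply: gapn; first exact: expR_ge0.
    move=> k /andP[Kk kb]; split=> //.
    by rewrite ler_expR !mulNr lerN2 ler_pM2l // ler_nat ltnW.
  by rewrite ler_wpM2r ?(ltW N0) // ler_pdivrMr.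
have ep := edgep_prob (adj n) pn.
apply: (@le_trans _ _ (prob (edgep (adj n) (alpha / D n))
   (fun F => (q + e / 2) * N n < (nverts (fun k => (k <= K)%N) F)%:R) +
   prob (edgep (adj n) (alpha / D n)) (fun F => e / 2 * N n <= (nverts J F)%:R))).
  apply: prob_le_union => // F Fe.
  have : (nverts (fun k => (k%:R <= b * N n)%R) F <= nverts (fun k => (k <= K)%N) F + nverts J F)%N.
    by apply: nvertsU => k kb; rewrite /J kb; case: leqP.
  rewrite -(ler_nat R) natrD => le1; apply/orP.
  by case: (ltP ((q + e / 2) * N n)) => h; [left|right; lra].
rewrite [leRHS](_ : x = x / 2 + x / 2); last by rewrite -splitr.
apply: lerD => //.
have eN : 0 < e / 2 * N n by rewrite mulr_gt0.
rewrite -(ler_pM2l eN) [leRHS](_ : _ = x / 2 * (e / 2) * N n); last by ring.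
apply: le_trans meanJ; apply: finite_markov => //; exact: ltW.
Unshelve. all: by end_near.
Qed.

Lemma subcritical_small (alpha : R) : 0 < alpha < 1 -> exists C : R,
  rare adj (fun n => alpha / D n) (fun n F =>
    [exists S in components F, C * ln (N n) < #|S|%:R]).
Proof.
move=> a01; have [g g0 sub] := subcritical_mean adj_sym adj_reg d_oo a01.
have a0 : 0 < alpha by case/andP: a01.
exists (2 / g).
apply: (@rare_mid_size alpha g (fun _ _ => true)) => //.
by apply: filterS sub => n sub I c c0 H; apply: sub => // k /H[].
Qed.

(** At density [alpha1] at least (1 - q1 - e) N vertices lie in components of linear size,
    typically. Sprinkling up to [alpha] leaves two of these unjoined with probability e^(-cN), which
    beats the N^2 pairs. *)
Lemma rare_no_giant (q alpha q1 alpha1 e : R) : 0 < q -> q < q1 -> q1 < 1 ->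
  alpha = dual_density q -> alpha1 = dual_density q1 -> 0 < e -> q1 + e < 1 ->
  rare adj (fun n => alpha / D n) (fun n F =>
    [forall L in components F, #|L|%:R < (1 - q1 - e) * N n]).
Proof.
move=> q0 qq1 q11 alphaE alpha1E e0 q1e.
have q101 : 0 < q1 < 1 by rewrite q11 (lt_trans q0).
have [b b0 [_ [few _]]] := supercritical_small_gap q101 alpha1E.
have a11 : 1 < alpha1 by rewrite alpha1E dual_density_gt1.
have aa1 : alpha1 < alpha by rewrite alphaE alpha1E dual_density_decr.
have a0 : 0 <= alpha by lra.
have a10 : 0 <= alpha1 by lra.
have {}few := few e e0.
(* Two sets larger than b N span at least d b^2 N / 2 pairs once [eps n] is below b^2 / 2, and each
   edge is sprinkled with probability at least (alpha - alpha1) / d. *)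
pose c := (alpha - alpha1) * b ^+ 2 / 2.
have b2 : 0 < b ^+ 2 / 2 by rewrite divr_gt0 // exprn_gt0.
have c0 : 0 < c by rewrite /c -mulrA mulr_gt0 //; lra.
have epsb : \forall n \near \oo, eps n < b ^+ 2 / 2 by apply: (cvgr_lt _ eps0).
have p01 := near_density d_oo a0.
have p101 := near_density d_oo a10.
move=> x x0; have x2 : 0 < x / 2 by lra.
have fewx := few _ x2.
have expx : \forall n \near \oo, N n ^+ 2 * expR (- c * N n) <= x / 2.
  (* The 27 comes from cubing e^y >= y at y = c N / 3, which outgrows N^2. *)
  have lim : 27 / c ^+ 3 * (N n)^-1 @[n --> \oo] --> 0.
    rewrite -[X in _ --> X](mulr0 (27 / c ^+ 3)).
    by apply: cvgM; [exact: cvg_cst|exact: NV0].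
  apply: filterS2 (near_gt_N N_oo 0) (cvgr_le _ lim _ x2) => n N0.
  apply: le_trans; rewrite mulNr expRN ler_pdivrMr ?expR_gt0 //.
  have -> : c * N n = 3%:R * (c * N n / 3) by field.
  rewrite expRM_natl.
  have h : c * N n / 3 <= expR (c * N n / 3).
    by have := @expR_ge1Dx R (c * N n / 3); lra.
  have cN : 0 <= c * N n / 3 by rewrite divr_ge0 // mulr_ge0 // ltW.
  have : (c * N n / 3) ^+ 3 <= expR (c * N n / 3) ^+ 3.
    by rewrite lerXn2r ?nnegrE ?expR_ge0.
  have w0 : 0 <= 27 / c ^+ 3 / N n.
    by rewrite !mulr_ge0 ?invr_ge0 ?exprn_ge0 // ltW.
  move=> /(ler_wpM2l w0); apply: le_trans.
  by rewrite le_eqVlt; apply/orP; left; apply/eqP; field; lra.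
near=> n.
have N0 : 0 < N n by near: n; exact: near_gt_N.
have d0 : 0 < D n by near: n; exact: near_gt_d.
have pn : 0 <= alpha / D n < 1 by near: n.
have pn1 : 0 <= alpha1 / D n < 1 by near: n.
have epsn : eps n < b ^+ 2 / 2 by near: n.
(* The density of the second round, solved from 1 - p = (1 - p1)(1 - p2). *)
pose p2 := (alpha / D n - alpha1 / D n) / (1 - alpha1 / D n).
have pp : (alpha - alpha1) / D n <= p2.
  have pp0 : 0 < (alpha - alpha1) / D n by rewrite divr_gt0 //; lra.
  rewrite /p2 -mulrBl ler_pdivlMr; last lra.
  by rewrite ler_piMr ?(ltW pp0) //; lra.
have p20 : 0 <= p2 <= 1.
  have pp0 : 0 <= (alpha - alpha1) / D n by rewrite divr_ge0 ?(ltW d0) //; lra.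
  rewrite (le_trans pp0 pp) /= /p2 ler_pdivrMr; lra.
have m0 : 0 < (1 - q1 - e) * N n by rewrite mulr_gt0 //; lra.
have pn1' : 0 <= alpha1 / D n <= 1 by lra.
have da1 : alpha1 < D n by near: n; exact: near_gt_d.
have pE : 1 - alpha / D n = (1 - alpha1 / D n) * (1 - p2).
  by rewrite /p2; field; lra.
have mix2 : forall S S' : {set T n},
     (d n)%:R * (#|S|%:R * #|S'|%:R / #|T n|%:R - eps n * #|T n|%:R) <=
     (npairs (adj n) S S')%:R by near: n.
apply: le_trans (@sprinkling R _ (adj n) _ _ _ _ (b * N n) (expR (- c * N n)) pn1' p20 pE m0 (expR_ge0 _) _) _.
  move=> S S' _ bS bS'.
  apply: (@le_trans _ _ (expR (- p2) ^+ npairs (adj n) S S')).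
    by rewrite lerXn2r ?nnegrE ?expR_ge0 ?onem_le_expR //; lra.
  rewrite -expRM_natr ler_expR !mulNr lerN2.
  apply: (@le_trans _ _ ((alpha - alpha1) / D n * (npairs (adj n) S S')%:R)); last first.
    by rewrite ler_wpM2r.
  have pp0 : 0 <= (alpha - alpha1) / D n by rewrite divr_ge0 ?(ltW d0) //; lra.
  apply: (@le_trans _ _ _ _ _ _ (ler_wpM2l pp0 (mix2 S S'))).
  rewrite mulrA divfK ?gt_eqF // /c -!mulrA ler_pM2l; last lra.
  have : b ^+ 2 * N n <= #|S|%:R * #|S'|%:R / N n.
    rewrite ler_pdivlMr // [leLHS](_ : _ = (b * N n) * (b * N n)); last by ring.
    by apply: ler_pM; rewrite ?mulr_ge0 ?(ltW b0) ?(ltW N0) ?(ltW bS) ?(ltW bS').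
  have : eps n * N n <= b ^+ 2 / 2 * N n by rewrite ler_pM2r // ltW.
  by lra.
rewrite [leRHS](_ : x = x / 2 + x / 2); last by rewrite -splitr.
apply: lerD; last by near: n.
apply: (@le_trans _ _ (prob (edgep (adj n) (alpha1 / D n)) (fun F =>
  (q1 + e) * N n < (nverts (fun k => k%:R <= b * N n) F)%:R))); last by near: n.
by apply: ler_prob => [|F]; [exact: edgep_prob|lra].
Unshelve. all: by end_near.
Qed.

(** Sprinkling yields a component of nearly (1 - q) N vertices. With the small components it
    exhausts almost everything, so any other component falls below b N and then, by the gap, below C
    ln N. The exact size is the complement of the small components. *)
Lemma giant_component (q alpha : R) : 0 < q < 1 -> alpha = dual_density q ->
  exists C e0 : R, 0 < e0 /\ forall e, 0 < e <= e0 ->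
  rare adj (fun n => alpha / D n) (fun n F =>
    ~~ [exists L in components F,
         (`|#|L|%:R - (1 - q) * N n| <= e * N n) &&
         [forall K in components F, (K != L) ==> (#|K|%:R <= C * ln (N n))]]).
Proof.
move=> /andP[q0 q1] alphaE.
have q01 : 0 < q < 1 by rewrite q0 q1.
have [b b0 [C [many gap]]] := supercritical_small_gap q01 alphaE.
(* The distance from [q] to the sprinkling parameter: the first bound gives x + 2e < b, the second q
   + x + e < 1. *)
pose x := Num.min (b / 4) ((1 - q) / 2).
have [x0 xb xq] : [/\ 0 < x, x <= b / 4 & x <= (1 - q) / 2].
  by rewrite /x lt_min !ge_min !lexx orbT; split=> //; apply/andP; split; lra.
exists C, (Num.min (b / 4) ((1 - q) / 4)); split.
  by rewrite lt_min; apply/andP; split; lra.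
move=> e /andP[e_gt0]; rewrite le_min => /andP[eb eq].
have a1 : 1 < alpha by rewrite alphaE dual_density_gt1.
have a0 : 0 <= alpha by lra.
have p01 := near_prob a0.
have big : rare adj (fun n => alpha / D n) (fun n F =>
    [forall L in components F, #|L|%:R < (1 - (q + x) - e) * N n]).
  by apply: (rare_no_giant q0 _ _ alphaE erefl e_gt0); lra.
have [K few] := rare_few_small adj_sym adj_reg d_oo N_oo q01 alphaE e_gt0.
pose B1 n (F : {set {set T n}}) := [forall L in components F, #|L|%:R < (1 - (q + x) - e) * N n]
  || ((nverts (fun k => (k <= K)%N) F)%:R < (q - e) * N n).
pose B2 n (F : {set {set T n}}) := ((q + e) * N n < (nverts (fun k => k%:R <= b * N n) F)%:R)
  || [exists S in components F, (#|S|%:R <= b * N n) && (C * ln (N n) < #|S|%:R)].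
have rB1 : rare adj (fun n => alpha / D n) B1.
  by apply: (rareU p01 _ big few); apply: filterE.
have rB2 : rare adj (fun n => alpha / D n) B2.
  by apply: (rareU p01 _ (many e e_gt0) gap); apply: filterE.
apply: (rareU p01 _ rB1 rB2).
have kx : 0 < 1 - (q + x) - e by lra.
near=> n => F.
have N0 : 0 < N n by near: n; exact: near_gt_N.
have KN1 : K%:R < (1 - (q + x) - e) * N n.
  by rewrite mulrC -ltr_pdivrMr //; near: n; exact: near_gt_N.
have KN2 : K%:R < b * N n.
  by rewrite mulrC -ltr_pdivrMr //; near: n; exact: near_gt_N.
apply: contraR; rewrite !negb_or => /andP[/andP[/forall_inPn[L LF]]].
rewrite -!leNgt => Lbig fewF /andP[manyF /exists_inPn gapF].
have KL : (K < #|L|)%N by rewrite -(ltr_nat R); apply: lt_le_trans Lbig.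
have IL : ~~ (#|L| <= K)%N by rewrite -ltnNge.
have small S : S \in components F -> S != L -> #|S|%:R <= b * N n.
  move=> SF SL; case: (leqP #|S| K) => [SK|KS].
    by apply: le_trans (ltW KN2); rewrite ler_nat.
  have := two_components_le (I := fun k => (k <= K)%N) LF SF SL IL; rewrite -ltnNge => /(_ KS).
  rewrite -(ler_nat R) !natrD => tot.
  (* [L] and the components of size at most [K] leave at most (x + 2e) N vertices. *)
  have : (x + e *+ 2) * N n <= b * N n by rewrite ler_pM2r // mulr2n; lra.
  rewrite mulr2n; lra.
apply/exists_inP; exists L => //; apply/andP; split; last first.
  apply/forall_inP => S SF; apply/implyP => SL.
  by have := gapF S SF; rewrite negb_and small //= -leNgt.
have := one_component_le (I := fun k => (k <= K)%N) LF IL; rewrite -(ler_nat R) natrD => tot.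
have : N n <= (nverts (fun k => k%:R <= b * N n) F)%:R + #|L|%:R.
  rewrite -natrD ler_nat; apply: one_component_ge => S SF; rewrite -ltNge => bS.
  by apply/eqP; apply: contraLR bS => SL; rewrite -leNgt small.
move=> tot2; rewrite ler_norml; apply/andP; split; lra.
Unshelve. all: by end_near.
Qed.

End Giant.

(* delta n is the infimum of the errors e with P n e >= 1 - e, plus 1 / (n + 1). *)
Lemma exists_vanishing_error (R : realType) (P : nat -> R -> R) (e0 : R) :
  0 < e0 -> (\forall n \near \oo, forall e, P n e <= 1) ->
  (\forall n \near \oo, forall e e', e <= e' -> P n e <= P n e') ->
  (forall e, 0 < e <= e0 -> P n e @[n --> \oo] --> (1 : R)) ->
  exists delta : nat -> R, (delta @ \oo --> 0) /\
    (P n (delta n) @[n --> \oo] --> (1 : R)).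
Proof.
move=> e0_gt0 P1 Pmono Pcvg.
pose A n := [set e : R | 0 < e /\ 1 - e <= P n e].
have A_lb n : lbound (A n) 0 by move=> e [/ltW].
have A_near e : 0 < e -> \forall n \near \oo, exists2 e', A n e' & e' <= e.
  move=> e_gt0; pose m := Num.min e e0.
  have m0 : 0 < m by rewrite lt_min e_gt0.
  have mP : P n m @[n --> \oo] --> (1 : R).
    by apply: Pcvg; rewrite m0 ge_min lexx orbT.
  have : \forall n \near \oo, 1 - m <= P n m by apply: (cvgr_ge _ mP); lra.
  by apply: filterS => n nm; exists m; rewrite ?ge_min ?lexx.
pose delta n := inf (A n) + (n.+1%:R)^-1 : R.
have inf_cvg : inf (A n) @[n --> \oo] --> (0 : R).
  apply/cvgrPdist_le => e e_gt0; apply: filterS (A_near e e_gt0) => n [e' Ae' e'e].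
  have inf0 : 0 <= inf (A n) by apply: lb_le_inf; [exists e'|exact: A_lb].
  rewrite sub0r normrN ger0_norm //; apply: le_trans e'e.
  by apply: ge_inf Ae'; exists 0; exact: A_lb.
have delta_cvg : delta @ \oo --> 0.
  rewrite -[X in _ --> X](addr0 0); apply: cvgD => //.
  exact: cvg_harmonic.
exists delta; split=> //.
have sq : \forall n \near \oo, 1 - delta n <= P n (delta n) <= 1.
  apply: filterS3 P1 Pmono (A_near _ e0_gt0) => n P1 Pmono [e Ae _].
  rewrite P1 andbT.
  have hinf : has_inf (A n) by split; [exists e|exists 0; exact: A_lb].
  have n0 : 0 < (n.+1%:R)^-1 :> R by rewrite invr_gt0.
  (* The term 1 / (n + 1) leaves room for an admissible error below [delta n], as the infimum need
     not be attained. *)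
  have [e' [_ Pe'] e'lt] := inf_adherent n0 hinf.
  by apply: le_trans (Pmono _ _ (ltW e'lt)); apply: le_trans Pe'; rewrite lerD2l lerN2 ltW.
apply: (squeeze_cvgr sq); last exact: cvg_cst.
by rewrite -[X in _ --> X](subr0 1); apply: cvgB => //; exact: cvg_cst.
Qed.

(** The function x e^(-x) is negative for x < 0, increases on [0, 1] and decreases from 1 on; both
    monotonicities follow from e^t > 1 + t. *)
Lemma dual_ratio (R : realType) (alpha : R) : 1 < alpha ->
  exists2 a' : R, 0 < a' < 1 &
    forall x, (x * expR (- x) = alpha * expR (- alpha) /\ x <> alpha) <-> x = a'.
Proof.
move=> a1; pose f x : R := x * expR (- x).
have fmono x y : 0 <= x -> x < y -> y <= 1 -> f x < f y.
  move=> x0 xy y1; rewrite /f.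
  have h : 1 - (y - x) < expR (- (y - x)) by apply: expR_gt1Dx; lra.
  have -> : expR (- x) = expR (y - x) * expR (- y) by rewrite -expRD; congr expR; ring.
  rewrite mulrA ltr_pM2r ?expR_gt0 // -ltr_pdivlMr ?expR_gt0 // -expRN.
  have y0 : 0 < y by lra.
  have : y * (1 - (y - x)) < y * expR (- (y - x)) by rewrite ltr_pM2l.
  by apply: le_lt_trans; nra.
have fanti x y : 1 <= x -> x < y -> f y < f x.
  move=> x1 xy; rewrite /f.
  have h : 1 + (y - x) < expR (y - x) by apply: expR_gt1Dx; lra.
  have -> : expR (- x) = expR (y - x) * expR (- y) by rewrite -expRD; congr expR; ring.
  rewrite mulrA ltr_pM2r ?expR_gt0 //.
  have : x * (1 + (y - x)) < x * expR (y - x) by rewrite ltr_pM2l //; lra.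
  by apply: le_lt_trans; nra.
have fa0 : 0 < f alpha by rewrite mulr_gt0 ?expR_gt0 //; lra.
have f0 : f 0 = 0 by rewrite /f mul0r.
have fa1 : f alpha < f 1 by apply: fanti.
have [] := @IVT R f 0 1 (f alpha) ler01.
- apply: continuous_subspaceT => x; apply: cvgM; first exact: cvg_id.
  by apply: continuous_comp; [exact: opp_continuous|exact: continuous_expR].
- by rewrite f0 ge_min le_max (ltW fa0) (ltW fa1) orbT.
move=> a' /[!in_itv] /= /andP[a'0 a'1] fa'.
have a'n0 : a' != 0 by apply: contraTneq fa0 => a0; rewrite -fa' a0 f0 ltxx.
have a'n1 : a' != 1 by apply: contraTneq fa1 => a0; rewrite -fa' a0 ltxx.
have a'01 : 0 < a' < 1 by rewrite !lt_neqAle a'0 a'1 a'n1 eq_sym a'n0.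
exists a' => // x; split=> [[fx xa]|->]; last first.
  by split=> // aa; move: a'01; rewrite aa; lra.
have {}fx : f x = f alpha := fx.
have [x0|x0] := ltP x 0.
  suff : f x < 0 by rewrite fx; lra.
  by rewrite /f nmulr_rlt0 ?expR_gt0.
have [x1|x1] := leP x 1.
  case: (ltgtP x a') => // xa'.
    by have := fmono _ _ x0 xa' a'1; rewrite fx fa' ltxx.
  by have := fmono _ _ a'0 xa' x1; rewrite fx fa' ltxx.
case: (ltgtP x alpha) xa => // xa _.
  by have := fanti _ _ (ltW x1) xa; rewrite fx ltxx.
by have := fanti _ _ (ltW a1) xa; rewrite fx ltxx.
Qed.

(** * Johnson graphs *)

Lemma leq_bin_self m n : (0 < m < n)%N -> (n <= 'C(n, m))%N.
Proof.
elim: n m => [|n IH] [|m] //=; rewrite ltnS => mn; rewrite binS.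
have [->|m0] := posnP m; first by rewrite bin0 bin1 addn1.
have [mE|mn'] := eqVneq m.+1 n.
  by rewrite mE binn add1n ltnS; apply: IH; rewrite m0 -mE ltnSn.
have : (n <= 'C(n, m.+1))%N by apply: IH; rewrite /= ltn_neqAle mn'.
have : (0 < 'C(n, m))%N by rewrite bin_gt0 ltnW.
lia.
Qed.

Lemma much_largerP (R : realType) (f g : nat -> nat) : much_larger R f g ->
  forall M : nat, \forall n \near \oo, (M * g n < f n)%N.
Proof.
(* [M.+1] gives the strict inequality when [g n] is positive. When [g n = 0], the quotient 0 / 0 = 0
   stays below [M.+1], so [f n] must be positive. *)
move=> /cvgeyPge H M; apply: filterS (H M.+1%:R) => n.
rewrite inver; case: (eqVneq (g n) 0%N) => [->|g0].
  rewrite eqxx muln0; case: (posnP (f n)) => [->|//].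
  by rewrite mul0e lee_fin lern0.
rewrite pnatr_eq0 (negbTE g0) -EFinM lee_fin ler_pdivlMr ?ltr0n ?lt0n //.
rewrite -natrM ler_nat; apply: leq_trans.
by rewrite ltn_pmul2r // lt0n.
Qed.

Section JohnsonAsymptotics.
Variables (R : realType) (r s : nat -> nat).
Hypotheses (n_r : much_larger R id r) (r_s : much_larger R r s).
Local Notation T n := (johnson_vertex n (r n)).
Local Notation adj n := (@johnson_adj n (r n) (s n)).
Local Notation d n := (degree (adj n)).
Local Notation eps n := (johnson_eps R n (r n) (s n)).

Lemma near_params : \forall n \near \oo, (s n < r n)%N /\ (3 * r n < n)%N.
Proof.
apply: filterS2 (much_largerP r_s 1) (much_largerP n_r 3) => n.
by rewrite mul1n.
Qed.

Lemma johnson_order_cvg : #|T n|%:R @[n --> \oo] --> (+oo : set_system R).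
Proof.
apply/cvgryPge => A; have A0 : 0 <= `|A| by exact: normr_ge0.
apply: filterS2 near_params (nbhs_infty_ge (Num.bound `|A|)) => n [sr rn] An.
apply: le_trans (ler_norm _) _; apply: le_trans (ltW (archi_boundP A0)) _.
rewrite ler_nat (leq_trans An) // johnson_card leq_bin_self //.
by apply/andP; split; lia.
Qed.

Lemma johnson_degree_cvg : (d n)%:R @[n --> \oo] --> (+oo : set_system R).
Proof.
apply/cvgryPge => A; have A0 : 0 <= `|A| by exact: normr_ge0.
apply: filterS2 near_params (nbhs_infty_ge (2 * Num.bound `|A|)) => n [sr rn] An.
apply: le_trans (ler_norm _) _; apply: le_trans (ltW (archi_boundP A0)) _.
have srn : (s n < r n <= n)%N by apply/andP; split; lia.
rewrite ler_nat (johnson_degreeE srn).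
have b1 : (0 < 'C(r n, s n))%N by rewrite bin_gt0 ltnW.
have b2 : (n - r n <= 'C(n - r n, r n - s n))%N.
  by apply: leq_bin_self; apply/andP; split; lia.
apply: leq_trans (leq_pmull _ b1); apply: leq_trans b2.
lia.
Qed.

Lemma johnson_eps_cvg : eps n @[n --> \oo] --> 0.
Proof.
apply/cvgrPdist_le => e e0; have e2 : 0 <= 2 / e by rewrite divr_ge0 // ltW.
pose M := Num.bound (2 / e); have Me : 2 / e < M%:R := archi_boundP e2.
have M0 : 0 < M%:R :> R by apply: le_lt_trans Me.
(* [M.+1] in the second comparison, because the denominator is n - r and loses one r. *)
apply: filterS3 near_params (much_largerP r_s M) (much_largerP n_r M.+1) => n [sr rn] Ms Mr.
have rn' : (r n < n)%N by lia.
rewrite sub0r normrN gtr0_norm; last exact: (johnson_eps_gt0 R sr rn').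
have r0 : 0 < (r n)%:R :> R by rewrite ltr0n; lia.
have nr0 : 0 < (n - r n)%:R :> R by rewrite ltr0n; lia.
have h (x y : nat) : 0 < y%:R :> R -> (M * x <= y)%N -> x%:R / y%:R <= e / 2 :> R.
  move=> y0 xy; rewrite ler_pdivrMr //.
  have : M%:R * x%:R <= y%:R :> R by rewrite -natrM ler_nat.
  have : 2 / e * x%:R <= M%:R * x%:R by rewrite ler_wpM2r // ltW.
  move=> h1 h2; have : e / 2 * (2 / e * x%:R) <= e / 2 * y%:R.
    by rewrite ler_pM2l ?divr_gt0 // (le_trans h1).
  by apply: le_trans; rewrite le_eqVlt; apply/orP; left; apply/eqP; field; lra.
rewrite /johnson_eps [leRHS](_ : e = e / 2 + e / 2); last by rewrite -splitr.
apply: lerD; apply: h => //; first exact: ltnW.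
rewrite mulSn in Mr; apply: (@leq_trans (M * r n)); last by lia.
by rewrite leq_mul2l leq_subr orbT.
Qed.

Lemma near_johnson_degree : \forall n \near \oo, (0 < d n)%N.
Proof.
move/cvgryPgt: johnson_degree_cvg => /(_ 0).
by apply: filterS => n; rewrite ltr0n.
Qed.

Lemma near_johnson_regular :
  \forall n \near \oo, forall v, #|neighbors (adj n) v| = d n.
Proof.
apply: filterS near_params => n [sr rn] v.
by apply: johnson_regular => //; lia.
Qed.

Lemma near_johnson_mixing : \forall n \near \oo, forall S : {set T n},
  (npairs (adj n) S S)%:R <=
    (d n)%:R * #|S|%:R * (#|S|%:R / #|T n|%:R + eps n) :> R.
Proof.
apply: filterS2 near_params near_johnson_degree => n [sr rn] d0 S.
have rn' : (r n < n)%N by lia.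
have e0 := johnson_eps_gt0 R sr rn'.
have dR0 : 0 < (d n)%:R :> R by rewrite ltr0n.
have := johnson_mixing R sr rn' S S d0; rewrite -expr2 -exprMn.
rewrite -(real_normK (num_real (_ - _))) ler_sqr ?nnegrE ?mulr_ge0 ?(ltW e0) //.
move=> /(le_trans (ler_norm _)).
by rewrite expr2; lra.
Qed.

Lemma near_johnson_mixing2 : \forall n \near \oo, forall S S' : {set T n},
  (d n)%:R * (#|S|%:R * #|S'|%:R / #|T n|%:R - eps n * #|T n|%:R) <=
  (npairs (adj n) S S')%:R :> R.
Proof.
apply: filterS2 near_params near_johnson_degree => n [sr rn] d0 S S'.
have rn' : (r n < n)%N by lia.
have e0 := johnson_eps_gt0 R sr rn'.
have dR0 : 0 < (d n)%:R :> R by rewrite ltr0n.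
have := johnson_mixing R sr rn' S S' d0.
set X := _ - _ => X2.
(* Replacing both sizes by [#|T n|] is wasteful but enough for sets of linear size. *)
have : X ^+ 2 <= ((d n)%:R * eps n * #|T n|%:R) ^+ 2.
  apply: (le_trans X2); rewrite [leRHS]exprMn ler_wpM2l ?sqr_ge0 // expr2.
  by apply: ler_pM => //; rewrite ler_nat max_card.
rewrite -(real_normK (num_real X)) ler_sqr ?nnegrE ?mulr_ge0 ?(ltW e0) //.
rewrite ler_norml => /andP[+ _]; rewrite /X.
by lra.
Qed.

End JohnsonAsymptotics.

Theorem theorem3p17 (R : realType) (r s : nat -> nat)
    (n_r : much_larger R id r) (r_s : much_larger R r s) :
  let G n := @johnson_adj n (r n) (s n) in
  let d n : R := (degree (G n))%:R in
  let N n : R := 'C(n, r n)%:R in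
  (forall alpha : R, 0 < alpha < 1 ->
    exists C : R,
      subgraph_prob (G n) (alpha / d n)
        (fun F => [forall K in components F, #|K|%:R <= C * ln (N n)])
      @[n --> \oo] --> (1 : R))
  /\
  (forall alpha : R, 1 < alpha ->
    exists alpha' : R,
      unique (fun x => x * expR (- x) = alpha * expR (- alpha) /\ x <> alpha)
        alpha' /\
      exists (delta : nat -> R) (C : R),
        (delta n @[n --> \oo] --> (0 : R)) /\
        (subgraph_prob (G n) (alpha / d n)
          (fun F => [exists L in components F,
            (`| #|L|%:R - (1 - alpha' / alpha) * N n |
               <= delta n * ((1 - alpha' / alpha) * N n)) &&
            [forall K in components F,
              (K != L) ==> (#|K|%:R <= C * ln (N n))]])
        @[n --> \oo] --> (1 : R))).
Proof.
move=> G d N.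
have NE n : N n = #|{: johnson_vertex n (r n)}|%:R by rewrite /N johnson_card.
have G_sym n : symmetric (G n) by exact: johnson_adj_sym.
have reg := near_johnson_regular n_r r_s.
have d_oo := johnson_degree_cvg n_r r_s.
have N_oo := johnson_order_cvg n_r r_s.
have eps0 := johnson_eps_cvg n_r r_s.
have mix := near_johnson_mixing n_r r_s.
have mix2 := near_johnson_mixing2 n_r r_s.
split=> [alpha a01|alpha a1].
  have a0 : 0 <= alpha by case/andP: a01 => /ltW.
  have [C rC] := subcritical_small G_sym reg d_oo N_oo a01.
  exists C; under eq_fun do rewrite subgraph_probE.
  have p01 := near_prob d_oo a0.
  apply: rare_cvg1 => //; apply: rare_sub rC => //; apply: filterE => n F /=.
  rewrite negb_forall_in => /exists_inP[S SF]; rewrite -ltNge NE => SC.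
  by apply/exists_inP; exists S.
have a0 : 0 < alpha by lra.
have [a' /andP[a'0 a'1] a'E] := dual_ratio a1; exists a'; split.
  by split=> [|x xE]; [apply/a'E|apply/esym/a'E].
pose q := a' / alpha; rewrite -/q.
have [eqa' _] : a' * expR (- a') = alpha * expR (- alpha) /\ a' <> alpha by apply/a'E.
have q01 : 0 < q < 1 by rewrite divr_gt0 //= ltr_pdivrMr //; lra.
(* The equation for [a'] says that q = e^(a' - alpha), so ln q = a' - alpha. *)
have qE : alpha = dual_density q.
  have -> : dual_density q = - (a' - alpha) / (1 - q); last by rewrite /q; field; lra.
  congr (- _ / _); rewrite -[RHS]expRK; congr ln.
  have e1 : expR (- a') != 0 by rewrite gt_eqF ?expR_gt0.
  apply: (mulIf e1); rewrite -expRD /q mulrAC eqa'.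
  rewrite (_ : a' - alpha - a' = - alpha); last by ring.
  by field; lra.
have [C [e0 [e0_gt0 rG]]] := giant_component G_sym reg d_oo N_oo eps0 mix mix2 q01 qE.
have p01 := near_prob d_oo (ltW a0).
have q1 : 0 < 1 - q by lra.
pose good n e (F : {set {set johnson_vertex n (r n)}}) :=
  [exists L in components F,
    (`| #|L|%:R - (1 - q) * N n| <= e * ((1 - q) * N n)) &&
    [forall K in components F, (K != L) ==> (#|K|%:R <= C * ln (N n))]].
pose P n e := prob (edgep (G n) (alpha / d n)) (good n e).
(* The error is now relative to (1 - q) N, while [giant_component] measures it relative to N; hence
   the division. *)
have [||||delta [delta0 Pdelta]] := @exists_vanishing_error R P (e0 / (1 - q)).
- exact: divr_gt0.
- by apply: filterS p01 => n pn e; apply: prob_le1; exact: edgep_prob.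
- apply: filterS p01 => n pn e e' ee'.
  apply: ler_prob => [|F]; first exact: edgep_prob.
  move=> /exists_inP[L LF /andP[Le Lo]]; apply/exists_inP; exists L => //.
  by rewrite Lo andbT (le_trans Le) // ler_wpM2r // mulr_ge0 // ltW.
- move=> e /andP[e_gt0 ele]; apply: rare_cvg1 => //.
  apply: rare_sub (rG (e * (1 - q)) _) => //; last first.
    by rewrite mulr_gt0 //= -ler_pdivlMr.
  apply: filterE => n F /=; apply: contra => /exists_inP[L LF LL].
  by apply/exists_inP; exists L => //; rewrite mulrA NE.
exists delta, C; split=> //.
by under eq_fun do rewrite subgraph_probE.
Qed.
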